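(* Let $\mathcal{S}=\{S_k\le\mathrm{Sym}(m_k)\}_{k\in\mathbb{N}}$ be a sequence of perfect $2$-generated transitive permutation groups, with $m_k\ge 2$ for all $k$. Suppose that for every $k\in\mathbb{N}$ and every two distinct $i,j\in\{1,\ldots,m_k\}$ we have $\mathrm{St}_{S_k}(i)\neq\mathrm{St}_{S_k}(j)$. Then the infinitely iterated exponentiation $\varprojlim\widetilde{S}_n$ of the groups in $\mathcal{S}$ is topologically generated by $3$ elements.
   Context: Here $\mathbb{N}=\{1,2,3,\ldots\}$, actions are right actions, $\mathrm{Sym}(m)$ is the symmetric group on $\{1,\ldots,m\}$, and $\mathrm{St}_G(i)$ is the stabiliser of the point $i$ in $G$. A group is $2$-generated if it can be generated by two elements. Exponentiation: for permutation groups $A\le \mathrm{Sym}(m)$ and $B\le\mathrm{Sym}(n)$, the abstract wreath product is $A^n\rtimes B$, where $B$ permutes the $n$ coordinates of $A^n$ (the entry in position $t$ is moved by $b\in B$ to position $t^b$). The exponentiation of $A$ by $B$ is this group regarded as a permutation group on $\{1,\ldots,m\}^n$ with the product action: $(a_1,\ldots,a_n)\in A^n$ acts by $(i_1,\ldots,i_n)\mapsto (i_1^{a_1},\ldots,i_n^{a_n})$, and $b\in B$ permutes coordinates, moving the entry in position $t$ to position $t^b$. Iterated exponentiation: put $\widetilde{m}_1=m_1$, $\widetilde{S}_1=S_1\le\mathrm{Sym}(\widetilde{m}_1)$, and for $k\ge 2$ let $\widetilde{m}_k=m_k^{\widetilde{m}_{k-1}}$ and let $\widetilde{S}_k=S_k^{\widetilde{m}_{k-1}}\rtimes\widetilde{S}_{k-1}$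 be the exponentiation of $S_k$ by $\widetilde{S}_{k-1}$, acting on $\{1,\ldots,m_k\}^{\widetilde{m}_{k-1}}$, which is identified with $\{1,\ldots,\widetilde{m}_k\}$ via the lexicographic order. The groups $\widetilde{S}_k$ with the natural projections $\widetilde{S}_k\to\widetilde{S}_{k-1}$ form an inverse system of finite groups; the profinite group $\varprojlim\widetilde{S}_k$ is the infinitely iterated exponentiation of the groups in $\mathcal{S}$. *)

(* Defs.v *)
From HB Require Import structures.
From mathcomp Require Import mathcomp_extra boolp classical_sets topology function_spaces.
From mathcomp Require Import all_boot all_fingroup all_solvable.

Set Implicit Arguments.
Unset Strict Implicit.
Unset Printing Implicit Defensive.

Import GroupScope.

Section LexicographicOrder.
Variables m n : nat.
Implicit Types f g h : {ffun 'I_n -> 'I_m}.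

Definition lex_lt f g : bool :=
  [exists t, (f t < g t) && [forall s : 'I_n, (s < t) ==> (f s == g s)]].

Lemma lex_ltP f g :
  reflect (exists2 t : 'I_n, f t < g t & forall s : 'I_n, s < t -> f s = g s)
          (lex_lt f g).
Proof.
apply: (iffP existsP) => [[t /andP[lt_t /forallP eq_t]]|[t lt_t eq_t]]; exists t => //.
  by move=> s lt_st; apply/eqP; apply: implyP (eq_t s) lt_st.
by rewrite lt_t; apply/forallP => s; apply/implyP => /eq_t ->.
Qed.

Lemma lex_lt_irr f : lex_lt f f = false.
Proof. by apply/lex_ltP => -[t]; rewrite ltnn. Qed.

Lemma lex_lt_trans : transitive lex_lt.
Proof.
move=> g f h /lex_ltP[t lt_t eq_t] /lex_ltP[u lt_u eq_u]; apply/lex_ltP.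
have [lt_tu | lt_ut | /val_inj eq_tu] := ltngtP t u.
- by exists t => [|s lt_st]; [rewrite -eq_u | rewrite eq_t // eq_u // (ltn_trans lt_st)].
- by exists u => [|s lt_su]; [rewrite eq_t | rewrite eq_t ?eq_u // (ltn_trans lt_su)].
- exists t => [|s lt_st]; first by apply: ltn_trans lt_t _; rewrite eq_tu.
  by rewrite eq_t // eq_u // -eq_tu.
Qed.

Lemma lex_lt_total f g : f != g -> lex_lt f g || lex_lt g f.
Proof.
move=> neq_fg; have [t0 ne_t0]: exists t, f t != g t.
  by apply/existsP; apply: contraR neq_fg => /existsPn eq_fg;
     apply/eqP/ffunP => t; apply/eqP/negPn/eq_fg.
case: (@arg_minnP _ t0 (fun t => f t != g t) val ne_t0) => t ne_t min_t.
have eq_t (s : 'I_n) : s < t -> f s = g s.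
  by move=> lt_st; apply/eqP; apply: contraLR lt_st => /min_t; rewrite -leqNgt.
have [lt_t | lt_t | /val_inj eq_ft] := ltngtP (f t) (g t).
- by apply/orP; left; apply/lex_ltP; exists t.
- by apply/orP; right; apply/lex_ltP; exists t => // s /eq_t.
- by rewrite eq_ft eqxx in ne_t.
Qed.

Lemma lex_rank_subproof f : #|[set g | lex_lt g f]| < (m ^ n)%N.
Proof.
have <-: #|[set: {ffun 'I_n -> 'I_m}]| = (m ^ n)%N by rewrite cardsT card_ffun !card_ord.
by apply/proper_card/properP; split; [apply/subsetP | exists f; rewrite ?inE ?lex_lt_irr].
Qed.

(* The position of f in the lexicographic order on {1..m}^n, counted from 0. *)
Definition lex_rank f : 'I_(m ^ n) := Ordinal (lex_rank_subproof f).

Lemma lex_rank_mono f g : lex_lt f g -> lex_rank f < lex_rank g.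
Proof.
move=> lt_fg; apply/proper_card/properP; split.
  by apply/subsetP => h; rewrite !inE => /lex_lt_trans; apply.
by exists f; rewrite !inE ?lex_lt_irr.
Qed.

Lemma lex_rank_inj : injective lex_rank.
Proof.
move=> f g eq_fg; apply/eqP; apply: contraT => /lex_lt_total.
by case/orP => /lex_rank_mono; rewrite eq_fg ltnn.
Qed.

Lemma lex_rank_onto x : x \in codom lex_rank.
Proof. by apply: (inj_card_onto lex_rank_inj); rewrite card_ffun !card_ord. Qed.

Definition lex_unrank (x : 'I_(m ^ n)) : {ffun 'I_n -> 'I_m} := iinv (lex_rank_onto x).

Lemma lex_unrankK : cancel lex_unrank lex_rank.
Proof. by move=> x; rewrite /lex_unrank f_iinv. Qed.

Lemma lex_rankK : cancel lex_rank lex_unrank.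
Proof. by move=> f; apply: lex_rank_inj; rewrite lex_unrankK. Qed.

End LexicographicOrder.

Section Exponentiation.
Variables m n : nat.
Implicit Types (a : {ffun 'I_n -> {perm 'I_m}}) (b : {perm 'I_n}).
Implicit Types (A : {group {perm 'I_m}}) (B : {group {perm 'I_n}}).

(* First a acts coordinatewise, then b moves the entry in position t to position b t;
   permutations act on the right, so this is the action of the product ab. *)
Definition prod_act a b (f : {ffun 'I_n -> 'I_m}) : {ffun 'I_n -> 'I_m} :=
  [ffun t => a (b^-1 t) (f (b^-1 t))].

Lemma prod_act_inj a b : injective (prod_act a b).
Proof.
move=> f g /ffunP eq_fg; apply/ffunP => t.
by have := eq_fg (b t); rewrite !ffunE permK => /perm_inj.
Qed.

Lemma exp_perm_subproof a b :
  injective (fun x : 'I_(m ^ n) => lex_rank (prod_act a b (lex_unrank x))).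
Proof.
by move=> x y /lex_rank_inj /prod_act_inj; apply: can_inj (@lex_unrankK m n) _ _.
Qed.

Definition exp_perm a b : {perm 'I_(m ^ n)} := perm (@exp_perm_subproof a b).

Lemma exp_permE a b f : exp_perm a b (lex_rank f) = lex_rank (prod_act a b f).
Proof. by rewrite permE lex_rankK. Qed.

Lemma exp_permM a b a' b' :
  exp_perm a b * exp_perm a' b' = exp_perm [ffun t => a t * a' (b t)] (b * b').
Proof.
apply/permP => x; rewrite -(lex_unrankK x) permM !exp_permE; congr lex_rank.
by apply/ffunP => t; rewrite !ffunE invMg !permM permKV.
Qed.

Definition exponentiation_set A B : {set {perm 'I_(m ^ n)}} :=
  [set exp_perm a b | a in [set a : {ffun 'I_n -> {perm 'I_m}} | [forall t, a t \in A]], b in B].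

Lemma exponentiationP A B g :
  reflect (exists (a : {ffun 'I_n -> {perm 'I_m}}) b, [/\ forall t, a t \in A, b \in B & g = exp_perm a b])
          (g \in exponentiation_set A B).
Proof.
apply: (iffP imset2P) => [[a b]|[a [b [Aa Bb ->]]]].
  by rewrite inE => /forallP Aa Bb ->; exists a, b.
by exists a b => //; rewrite inE; apply/forallP.
Qed.

Lemma exponentiation_group_set A B : group_set (exponentiation_set A B).
Proof.
apply/group_setP; split => [|g h].
  apply/exponentiationP; exists [ffun=> 1], 1; split=> // [t|]; first by rewrite ffunE.
  apply/permP => x; rewrite -(lex_unrankK x) exp_permE perm1; congr lex_rank.
  by apply/ffunP => t; rewrite !ffunE invg1 !perm1.
move=> /exponentiationP[a [b [Aa Bb ->]]] /exponentiationP[a' [b' [Aa' Bb' ->]]].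
apply/exponentiationP; rewrite exp_permM.
by do 2!eexists; split; last reflexivity; [move=> t; rewrite ffunE groupM | rewrite groupM].
Qed.

Definition exponentiation A B : {group {perm 'I_(m ^ n)}} :=
  Group (exponentiation_group_set A B).

(* The projection ab |-> b from the exponentiation to the top group; for 1 < m the
   action of the wreath product is faithful, so that b is determined by ab. *)
Definition exp_proj (g : {perm 'I_(m ^ n)}) : {perm 'I_n} :=
  odflt 1 [pick b | [exists a : {ffun 'I_n -> {perm 'I_m}}, g == exp_perm a b]].

Lemma exp_perm_top_inj a b a' b' : 1 < m -> exp_perm a b = exp_perm a' b' -> b = b'.
Proof.
move=> m_gt1 eq_p; have m_gt0 := ltnW m_gt1.
have eq_act f : prod_act a b f = prod_act a' b' f.
  by apply: lex_rank_inj; rewrite -!exp_permE eq_p.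
pose i0 : 'I_m := Ordinal m_gt0; pose i1 : 'I_m := Ordinal m_gt1.
apply/permP => t; apply: contraTeq isT => ne_bt.
pose f0 := [ffun _ : 'I_n => i0]; pose f1 := [ffun s => if s == t then i1 else i0].
have /ffunP/(_ (b t)) := eq_act f0; have /ffunP/(_ (b t)) := eq_act f1.
have ne_t: b'^-1 (b t) != t by apply: contra ne_bt => /eqP {2}<-; rewrite permKV.
by rewrite !ffunE permK eqxx (negPf ne_t) => <- /perm_inj /(congr1 val).
Qed.

Lemma exp_projE a b : 1 < m -> exp_proj (exp_perm a b) = b.
Proof.
move=> m_gt1; rewrite /exp_proj; case: pickP => [b' /existsP[a' /eqP]|/(_ b)/existsP[]].
  by move=> /(exp_perm_top_inj m_gt1).
by exists a.
Qed.

Lemma exp_projM A B : 1 < m ->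
  {in exponentiation A B &, {morph exp_proj : g h / g * h}}.
Proof.
move=> m_gt1 _ _ /exponentiationP[a [b [_ _ ->]]] /exponentiationP[a' [b' [_ _ ->]]].
by rewrite exp_permM !exp_projE.
Qed.

Definition exp_proj_morphism A B (m_gt1 : 1 < m) :
  {morphism exponentiation A B >-> {perm 'I_n}} := Morphism (exp_projM m_gt1).

Lemma exp_proj_im A B (m_gt1 : 1 < m) :
  exp_proj_morphism A B m_gt1 @* exponentiation A B = B.
Proof.
apply/setP => b; apply/morphimP/idP => [[g _ /exponentiationP[a [b' [_ Bb ->]]] ->]|Bb].
  by rewrite /= exp_projE.
exists (exp_perm [ffun=> 1] b); rewrite /= ?exp_projE //.
all: by apply/exponentiationP; exists [ffun=> 1], b; split=> // t; rewrite ffunE.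
Qed.

End Exponentiation.

Section IteratedExponentiation.
Variables (m : nat -> nat) (S : forall k, {group {perm 'I_(m k)}}).

(* Sequences are indexed from 0: m k and S k are the terms usually numbered k.+1. *)
Fixpoint iter_exp_deg k : nat :=
  if k is k'.+1 then (m k ^ iter_exp_deg k')%N else m 0.

Fixpoint iter_exp k : {group {perm 'I_(iter_exp_deg k)}} :=
  match k return {group {perm 'I_(iter_exp_deg k)}} with
  | 0 => S 0
  | k'.+1 => exponentiation (S k'.+1) (iter_exp k')
  end.

Definition iter_exp_proj (m_gt1 : forall k, 1 < m k) k :
    {morphism iter_exp k.+1 >-> {perm 'I_(iter_exp_deg k)}} :=
  exp_proj_morphism (S k.+1) (iter_exp k) (m_gt1 k.+1).

End IteratedExponentiation.

HB.mixin Record isTopologicalGroup G of monoid.Group G & Topological G := {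
  mulg_continuous : continuous (fun p : G * G => p.1 * p.2);
  invg_continuous : continuous (fun x : G => x^-1)
}.

HB.structure Definition TopologicalGroup :=
  {G of monoid.Group G & Topological G & isTopologicalGroup G}.

Section TopologicalGeneration.
Local Open Scope classical_set_scope.

Definition is_subgroup (G : groupType) (H : set G) : Prop :=
  H 1 /\ forall x y, H x -> H y -> H (x * y^-1).

Definition subgroup_generated (G : groupType) (X : set G) : set G :=
  smallest (@is_subgroup G) X.

Definition topologically_generates (G : TopologicalGroup.type) (X : set G) : Prop :=
  dense (subgroup_generated X).

End TopologicalGeneration.

Section InverseLimit.
Variables (gT : nat -> finGroupType) (G : forall k, {group gT k}).
Variable pi : forall k, {morphism G k.+1 >-> gT k}.
Local Open Scope classical_set_scope.

Definition inv_lim_set : set (prod_topology (fun k => discrete_topology (gT k))) :=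
  [set x | forall k, (x k : gT k) \in G k /\ pi k (x k.+1) = x k].

(* The topology is the one induced by the product of the discrete groups. *)
Definition inv_lim : Type := classical_sets.set_type inv_lim_set.
HB.instance Definition _ := Topological.on inv_lim.

Implicit Types x y z : inv_lim.

Lemma inv_lim_mem x k : (val x k : gT k) \in G k.
Proof. by have /set_mem/(_ k)[] := valP x. Qed.

Lemma inv_lim_compat x k : pi k (val x k.+1) = val x k.
Proof. by have /set_mem/(_ k)[] := valP x. Qed.

Lemma inv_lim_one_subproof : inv_lim_set (fun k => 1 : gT k).
Proof. by move=> k; rewrite group1 morph1. Qed.

Lemma inv_lim_mul_subproof x y :
  inv_lim_set (fun k => (val x k : gT k) * (val y k : gT k)).
Proof.
move=> k; rewrite groupM ?inv_lim_mem //; split=> //.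
by rewrite morphM ?inv_lim_mem // !inv_lim_compat.
Qed.

Lemma inv_lim_inv_subproof x : inv_lim_set (fun k => (val x k : gT k)^-1).
Proof.
move=> k; rewrite groupV inv_lim_mem; split=> //.
by rewrite morphV ?inv_lim_mem // inv_lim_compat.
Qed.

Definition inv_lim_one : inv_lim := SigSub (mem_set inv_lim_one_subproof).
Definition inv_lim_mul x y : inv_lim := SigSub (mem_set (inv_lim_mul_subproof x y)).
Definition inv_lim_inv x : inv_lim := SigSub (mem_set (inv_lim_inv_subproof x)).

Lemma inv_lim_mulA : associative inv_lim_mul.
Proof. by move=> x y z; apply/val_inj/functional_extensionality_dep => k /=; apply: mulgA. Qed.

Lemma inv_lim_mul1 : left_id inv_lim_one inv_lim_mul.
Proof. by move=> x; apply/val_inj/functional_extensionality_dep => k /=; apply: mul1g. Qed.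

Lemma inv_lim_1mul : right_id inv_lim_one inv_lim_mul.
Proof. by move=> x; apply/val_inj/functional_extensionality_dep => k /=; apply: mulg1. Qed.

Lemma inv_lim_mulV : left_inverse inv_lim_one inv_lim_inv inv_lim_mul.
Proof. by move=> x; apply/val_inj/functional_extensionality_dep => k /=; apply: mulVg. Qed.

Lemma inv_lim_Vmul : right_inverse inv_lim_one inv_lim_inv inv_lim_mul.
Proof. by move=> x; apply/val_inj/functional_extensionality_dep => k /=; apply: mulgV. Qed.

HB.instance Definition _ := isGroup.Build inv_lim
  inv_lim_mulA inv_lim_mul1 inv_lim_1mul inv_lim_mulV inv_lim_Vmul.

Lemma inv_lim_near x k : \forall y \near x, val y k = val x k.
Proof.
have cont_k : continuous (fun y : inv_lim => (val y k : discrete_topology (gT k))).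
  move=> y; apply: (@continuous_comp inv_lim _ _ val (@proj _ _ k)).
    exact: initial_continuous.
  exact: (@proj_continuous nat (fun k => discrete_topology (gT k))).
exact: (cont_k x [set val x k] (discrete_set1 _)).
Qed.

Lemma inv_lim_continuous (X : topologicalType) (f : X -> inv_lim) :
  (forall k u, \forall v \near u, val (f v) k = val (f u) k) -> continuous f.
Proof.
move=> near_f; apply: continuous_comp_initial => u; apply/cvg_sup => k.
move=> U [V [[W _ <-] /= Wu sub_WU]]; apply: filterS (near_f k u) => v eq_v.
apply: sub_WU => /=; have: W (val (f v) k) by rewrite eq_v; exact: Wu.
by [].
Qed.

Lemma inv_lim_mul_continuous : continuous (fun p : inv_lim * inv_lim => p.1 * p.2).
Proof.
apply: inv_lim_continuous => k [x y].
exists ([set x' | val x' k = val x k], [set y' | val y' k = val y k]).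
  by split; apply: inv_lim_near.
by move=> [x' y'] /= [eq_x eq_y]; congr (_ * _).
Qed.

Lemma inv_lim_inv_continuous : continuous (fun x : inv_lim => x^-1).
Proof.
apply: inv_lim_continuous => k x; apply: filterS (inv_lim_near x k) => y /= eq_y.
by congr (_^-1).
Qed.

HB.instance Definition _ :=
  isTopologicalGroup.Build inv_lim inv_lim_mul_continuous inv_lim_inv_continuous.

End InverseLimit.

Definition infinitely_iterated_exponentiation (m : nat -> nat)
    (S : forall k, {group {perm 'I_(m k)}}) (m_gt1 : forall k, 1 < m k) :
    TopologicalGroup.type :=
  inv_lim (iter_exp_proj S m_gt1).

(* Main.v *)
Require Import Defs.
From HB Require Import structures.
From mathcomp Require Import mathcomp_extra boolp classical_sets topology function_spaces.
From mathcomp Require Import all_boot all_fingroup all_solvable.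
From mathcomp Require Import zify.

Set Implicit Arguments.
Unset Strict Implicit.
Unset Printing Implicit Defensive.

Import GroupScope.

(** The three generators are built level by level.  A set of elements of the
    inverse limit generates a dense subgroup as soon as its image generates
    every level (inv_lim_topologically_generates), so it suffices to show
    that a generating triple (x, y, z) of a level B, a permutation group on I,
    lifts to a generating triple of the next level, the wreath product of
    S = <s, t> by B.  A lift is a choice of three labellings a, b, c : I -> S,
    which gives the elements (a, x), (b, y), (c, z).  All levels are
    transitive with pairwise distinct point stabilisers.

    First lift.  The bottom level is 2-generated, so z = 1 is possible there.
    Then (1, x) and (1, y) generate the top group, and c is taken to be s at
    one point, t at another and 1 elsewhere.  Conjugates of c carry s (or t)
    to any point o while being trivial at any given j <> o; since S is
    perfect, iterated commutators produce every element of the base group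
    (wreath_base_step).

    Later lifts rest on a criterion (wreath_mod_max): a subgroup H of the
    wreath product that maps onto B is everything if some coordinate maps the
    stabiliser in H of the corresponding point onto S, and if H covers the
    wreath product of S / K by B for each maximal normal subgroup K of S.
    Distinct stabilisers are what prevents H from tying together coordinates
    at two different points through two different K.  The first condition is
    met by imposing that the product of a along the x-cycle of o is s and the
    product of b along the y-cycle of o is t.  As S is perfect, labellings may
    be prescribed independently modulo the various K (maxnormal_chinese), so
    everything reduces to one simple non-abelian quotient T = S / K.

    For T the existence of good labellings is a counting argument
    (simple_generating_labelling).  Put n = #|I| and q = #|T|.  The two cycle
    conditions leave q ^ (3 n - 2) labellings.  A bad one generates a subgroup
    H meeting the base group in some N of one of two kinds.  Either N is
    trivial, so that H is a complement isomorphic to B; H is then determined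
    by a transversal and by the images of generators of a point stabiliser, in
    at most q ^ (n + log #|B|) ways.  Or N is a product of diagonal subgroups,
    one for each class of a partition of I into classes of size at least 2;
    H is then determined by the class of o, by an automorphism of T (that is,
    by the images of s and t) for each point outside a transversal of the
    classes, and by the labels on this transversal, in at most
    2 ^ n * q ^ (2 n + n / 2) ways.  From the second level on, I consists of
    all functions from a set of at least 3 points to a set of at least 3
    points, so n >= 27 and #|B| <= 2 ^ (2 n - 3); both numbers are then at most
    q ^ (3 n - 3), and some labelling is good. *)

(** * Wreath products as labelled permutations *)

Section Wreath.
Variables (gT : finGroupType) (I : finType).

Definition wreath : Type := ({ffun I -> gT} * {perm I})%type.
HB.instance Definition _ := Finite.on wreath.
Implicit Types (u v w : wreath) (i j o : I) (J : {set I}).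

Definition wreath_mul u v : wreath := ([ffun i => u.1 i * v.1 (u.2 i)], u.2 * v.2).
Definition wreath_one : wreath := ([ffun=> 1], 1).
Definition wreath_inv u : wreath := ([ffun i => (u.1 (u.2^-1 i))^-1], u.2^-1).

Lemma wreath_mulA : associative wreath_mul.
Proof.
move=> u v w; congr (_, _); last exact: mulgA.
by apply/ffunP=> i; rewrite !ffunE /= permM mulgA.
Qed.

Lemma wreath_mul1 : left_id wreath_one wreath_mul.
Proof.
case=> a b; congr (_, _); last exact: mul1g.
by apply/ffunP=> i; rewrite !ffunE /= perm1 mul1g.
Qed.

Lemma wreath_mulV : left_inverse wreath_one wreath_inv wreath_mul.
Proof.
move=> u; congr (_, _); last exact: mulVg.
by apply/ffunP=> i; rewrite !ffunE /= mulVg.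
Qed.

HB.instance Definition _ :=
  Finite_isGroup.Build wreath wreath_mulA wreath_mul1 wreath_mulV.

Lemma labM u v i : (u * v).1 i = u.1 i * v.1 (u.2 i).
Proof. by rewrite ffunE. Qed.

Lemma topM u v : (u * v).2 = u.2 * v.2. Proof. by []. Qed.

Lemma lab1 i : (1 : wreath).1 i = 1. Proof. by rewrite ffunE. Qed.

Lemma top1 : (1 : wreath).2 = 1. Proof. by []. Qed.

Lemma labV u i : (u^-1).1 i = (u.1 (u.2^-1 i))^-1.
Proof. by rewrite ffunE. Qed.

Lemma topV u : (u^-1).2 = u.2^-1. Proof. by []. Qed.

Lemma wreathP u v : (forall i, u.1 i = v.1 i) -> u.2 = v.2 -> u = v.
Proof.
by move=> eq1 eq2; rewrite (surjective_pairing u) (surjective_pairing v) eq2;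
   congr (_, _); apply/ffunP.
Qed.

Lemma lab_conj u w i : u.2 = 1 -> (u ^ w).1 (w.2 i) = u.1 i ^ w.1 i.
Proof.
by move=> u1; rewrite conjgE !labM labV topV permK u1 perm1 conjgE mulgA.
Qed.

Lemma top_conj u w : (u ^ w).2 = u.2 ^ w.2.
Proof. by []. Qed.

Definition wreath_group_set (S : {set gT}) (B : {set {perm I}}) : {set wreath} :=
  [set w : wreath | [forall i, w.1 i \in S] && (w.2 \in B)].

Lemma in_wreathP (S : {set gT}) (B : {set {perm I}}) w :
  reflect ((forall i, w.1 i \in S) /\ w.2 \in B) (w \in wreath_group_set S B).
Proof. by rewrite inE; apply: (iffP andP) => -[/forallP ? ?]. Qed.

Lemma wreath_group_setP (S : {group gT}) (B : {group {perm I}}) :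
  group_set (wreath_group_set S B).
Proof.
apply/group_setP; split=> [|u v /in_wreathP[Su Bu] /in_wreathP[Sv Bv]].
  by apply/in_wreathP; split=> [i|]; rewrite ?lab1 ?top1 group1.
by apply/in_wreathP; split=> [i|]; rewrite ?labM ?topM groupM.
Qed.
Canonical wreath_group S B := Group (wreath_group_setP S B).

(** On this subgroup, taking the label at i is a homomorphism. *)
Definition fixing i : {set wreath} := [set w : wreath | w.2 i == i].

Lemma fixing_group_set i : group_set (fixing i).
Proof.
apply/group_setP; split=> [|u v]; rewrite !inE ?top1 ?perm1 //.
by move=> /eqP ui /eqP vi; rewrite topM permM ui vi.
Qed.
Canonical fixing_group i := Group (fixing_group_set i).

Definition coord i w := w.1 i.

Lemma coordM i : {in fixing i &, {morph coord i : u v / u * v}}.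
Proof. by move=> u v; rewrite inE /coord labM => /eqP->. Qed.
Canonical coord_morphism i := Morphism (@coordM i).

(** For J empty this is the intersection of H with the base group; in general
    it is the kernel of the projection of that intersection to the coordinates
    in J. *)
Definition kern (H : {set wreath}) J : {set wreath} :=
  [set u : wreath in H | (u.2 == 1) && [forall j in J, u.1 j == 1]].

Lemma kernP (H : {set wreath}) J u :
  reflect [/\ u \in H, u.2 = 1 & forall j, j \in J -> u.1 j = 1] (u \in kern H J).
Proof.
rewrite inE; apply: (iffP and3P) => [[Hu /eqP u1 /forall_inP uJ]|[Hu u1 uJ]].
  by split=> // j /uJ/eqP.
by split=> //; [apply/eqP | apply/forall_inP=> j /uJ ->].
Qed.

Lemma kern_group_set (H : {group wreath}) J : group_set (kern H J).
Proof.
apply/group_setP; split=> [|u v /kernP[Hu u1 uJ] /kernP[Hv v1 vJ]].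
  by apply/kernP; split=> // j _; rewrite lab1.
apply/kernP; rewrite groupM // topM u1 v1 mulg1; split=> // j Jj.
by rewrite labM u1 perm1 uJ // vJ // mulg1.
Qed.
Canonical kern_group H J := Group (kern_group_set H J).

Lemma kern_fixing (H : {set wreath}) J i : kern H J \subset fixing i.
Proof. by apply/subsetP=> u /kernP[_ u1 _]; rewrite inE u1 perm1. Qed.

Lemma kern_coordP (H : {set wreath}) J i g :
  reflect (exists2 u, u \in kern H J & u.1 i = g) (g \in coord i @* kern H J).
Proof.
apply: (iffP idP) => [/morphimP[u _ ? ->]|[u uJ <-]]; first by exists u.
by apply: mem_morphim => //; apply: (subsetP (kern_fixing H J i)).
Qed.

Lemma kern_norm (H : {group wreath}) J w :
  w \in H -> (forall j, j \in J -> w.2 j \in J) -> w \in 'N(kern H J).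
Proof.
move=> Hw wJ; have eqJ : w.2 @: J = J.
  apply/eqP; rewrite eqEcard card_imset ?leqnn ?andbT; last exact: perm_inj.
  by apply/subsetP=> _ /imsetP[j Jj ->]; apply: wJ.
rewrite inE; apply/subsetP=> _ /imsetP[u /kernP[Hu u1 uJ] ->]; apply/kernP.
split; rewrite ?groupJ // ?top_conj ?u1 ?conj1g // => j.
by rewrite -{1}eqJ => /imsetP[i Ji ->]; rewrite lab_conj // uJ ?conj1g.
Qed.

End Wreath.


(** * Recovering the base group from coordinates *)

Section Independence.
Variables (gT : finGroupType) (I : finType).
Implicit Types (S : {group gT}) (H : {group wreath gT I}) (o i j : I).

(** A commutator of an element trivial on J :\ j with an element trivial at j
    is trivial on J, and S is generated by commutators of its elements; so the
    points of J can be killed one after the other without losing S at o. *)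
Lemma kern_coord_onto S H o :
    S^`(1) = S :> {set gT} -> S \subset coord o @* kern H set0 ->
    (forall j, j != o -> S \subset coord o @* kern H [set j]) ->
  S \subset coord o @* kern H [set~ o].
Proof.
move=> S_perfect onto0 onto1.
suffices: forall n (J : {set I}), #|J| <= n -> o \notin J -> S \subset coord o @* kern H J.
  by move/(_ #|[set~ o]| [set~ o] (leqnn _)); apply; rewrite !inE eqxx.
elim=> [|n IHn] J.
  by rewrite leqn0 cards_eq0 => /eqP->.
have [->|[j Jj]] := set_0Vmem J; first by [].
rewrite (cardsD1 j J) Jj ltnS => leJ oJ.
have jo : j != o by apply: contra oJ => /eqP<-.
have {}IHn : S \subset coord o @* kern H (J :\ j).
  by apply: IHn => //; rewrite in_setD1 negb_and oJ orbT.
apply: subset_trans (_ : coord o @* [~: kern H (J :\ j), kern H [set j]] \subset _).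
  by rewrite morphimR ?kern_fixing // -{1}S_perfect commgSS ?onto1.
apply: morphimS; rewrite gen_subG; apply/subsetP=> _ /imset2P[u v uJ vj ->].
have [[Hu u1 {}uJ] [Hv v1 {}vj]] := (kernP _ _ _ uJ, kernP _ _ _ vj).
apply/kernP; split=> [||i Ji]; first by rewrite groupR.
  by rewrite commgEl topM topV top_conj u1 conj1g invg1 mulg1.
rewrite commgEl labM topV u1 invg1 perm1 labV u1 invg1 perm1.
have := lab_conj v i u1; rewrite v1 perm1 => ->.
have [->|ji] := eqVneq i j; first by rewrite vj ?set11 // conjg1 mulVg.
by rewrite uJ ?conj1g ?invg1 ?mulg1 // in_setD1 ji.
Qed.

(** Elements supported at the single point o are moved by H to every other
    point, and they generate the base group. *)
Lemma base_sub S H o (B : {set {perm I}}) :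
    H \subset wreath_group_set S B -> (forall i, exists2 h, h \in H & h.2 o = i) ->
    S \subset coord o @* kern H [set~ o] ->
  forall u : wreath gT I, u.2 = 1 -> (forall i, u.1 i \in S) -> u \in H.
Proof.
move=> HS Htrans Ho.
have single i g : g \in S -> exists u : wreath gT I,
    [/\ u \in H, u.2 = 1, u.1 i = g & forall j, j != i -> u.1 j = 1].
  move=> Sg; have [h Hh <-] := Htrans i.
  have Sh : h.1 o \in S by have /in_wreathP[] := subsetP HS h Hh.
  have /(subsetP Ho)/kern_coordP[u /kernP[Hu u1 uo] ug] : g ^ (h.1 o)^-1 \in S.
    by rewrite groupJ // groupV.
  exists (u ^ h); rewrite groupJ // top_conj u1 conj1g lab_conj // ug conjgKV.
  split=> // j; rewrite -(permKV h.2 j) lab_conj // (inj_eq perm_inj) => jo.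
  by rewrite uo ?conj1g // !inE.
suffices: forall n (J : {set I}) (u : wreath gT I), #|J| <= n -> u.2 = 1 ->
    (forall i, u.1 i \in S) -> (forall i, i \notin J -> u.1 i = 1) -> u \in H.
  by move=> all u u1 Su; apply: (all #|I| setT); rewrite ?cardsT // => i; rewrite inE.
elim=> [|n IHn] J u leJ u1 Su uJ.
  have ->: u = 1.
    apply: wreathP => // i; rewrite lab1 uJ //; move: leJ.
    by rewrite leqn0 cards_eq0 => /eqP->; rewrite inE.
  exact: group1.
have [J0|[j Jj]] := set_0Vmem J; first by apply: (IHn J); rewrite // J0 cards0.
have [v [Hv v1 vj vN]] := single j _ (Su j).
rewrite -(mulKVg v u) groupM //; apply: (IHn (J :\ j)).
- by move: leJ; rewrite (cardsD1 j J) Jj.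
- by rewrite topM topV v1 u1 invg1 mulg1.
- move=> i; rewrite labM labV topV v1 invg1 !perm1 groupM // groupV.
  by have [->|/vN->] := eqVneq i j; rewrite ?group1 // vj.
- move=> i; rewrite in_setD1 negb_and negbK labM labV topV v1 invg1 !perm1.
  have [->|ij /uJ->] := eqVneq i j; first by rewrite vj mulVg.
  by rewrite vN // invg1 mulg1.
Qed.

Lemma wreath_sub S (B : {group {perm I}}) H :
    (forall b, b \in B -> exists2 h, h \in H & h.2 = b) ->
    H \subset wreath_group S B ->
    (forall u : wreath gT I, u.2 = 1 -> (forall i, u.1 i \in S) -> u \in H) ->
  H = wreath_group S B.
Proof.
move=> onto HS base; apply/val_inj/eqP; rewrite /= eqEsubset HS.
apply/subsetP=> w /in_wreathP[Sw /onto[h Hh hw]].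
have /in_wreathP[Sh _] := subsetP HS h Hh.
rewrite -(mulgKV h w) groupM //; apply: base => [|i].
  by rewrite topM topV hw mulgV.
by rewrite labM labV groupM // groupV.
Qed.
End Independence.

(** * Generation modulo the maximal normal subgroups *)

Section Criterion.
Variables (gT : finGroupType) (I : finType).
Variables (S : {group gT}) (B : {group {perm I}}) (H : {group wreath gT I}) (o : I).
Hypothesis S_perfect : S^`(1) = S :> {set gT}.
Hypothesis HS : H \subset wreath_group S B.
Hypothesis H_top : forall b, b \in B -> exists2 h, h \in H & h.2 = b.
Hypothesis B_trans : forall i, exists2 b, b \in B & b o = i.
Hypothesis H_onto : S \subset coord o @* (H :&: fixing gT o).

Lemma lab_in h i : h \in H -> h.1 i \in S.
Proof. by case/(subsetP HS)/in_wreathP. Qed.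

Lemma coord_kern_sub J i : coord i @* kern H J \subset S.
Proof. by apply/subsetP=> _ /kern_coordP[u /kernP[Hu _ _] <-]; apply: lab_in. Qed.

Lemma lift_trans i : exists2 h, h \in H & h.2 o = i.
Proof. by have [b Bb <-] := B_trans i; have [h Hh <-] := H_top Bb; exists h. Qed.

Lemma norm_kern0 : H \subset 'N(kern H set0).
Proof. by apply/subsetP=> w Hw; apply: kern_norm => // j; rewrite inE. Qed.

Lemma coord_kern0_norm : S \subset 'N(coord o @* kern H set0).
Proof.
apply: subset_trans H_onto _; apply: morphim_norms.
exact: subset_trans (subsetIl _ _) norm_kern0.
Qed.

Lemma coord_kern1_norm j :
  S \subset coord o @* kern H set0 -> S \subset 'N(coord o @* kern H [set j]).
Proof.
move=> onto0; apply: subset_trans onto0 _; apply: morphim_norms.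
apply/subsetP=> w /kernP[Hw w1 _]; apply: kern_norm => // i.
by rewrite w1 perm1.
Qed.

Lemma coord_kern0_trans i :
  S \subset coord o @* kern H set0 -> S \subset coord i @* kern H set0.
Proof.
move=> onto0; have [h Hh <-] := lift_trans i; apply/subsetP=> g Sg.
have /(subsetP onto0)/kern_coordP[u uN ug] : g ^ (h.1 o)^-1 \in S.
  by rewrite groupJ // groupV lab_in.
have [_ u1 _] := kernP _ _ _ uN.
apply/kern_coordP; exists (u ^ h).
  by rewrite memJ_norm // (subsetP norm_kern0).
by rewrite lab_conj // ug conjgKV.
Qed.

Lemma sub_maxnormal (A : {group gT}) :
  A \proper S -> S \subset 'N(A) -> exists2 K : {group gT}, maxnormal K S S & A \subset K.
Proof.
move=> pAS nAS.
have [|K maxK sAK] := @maxgroup_exists _ (fun K => (K \proper S) && (S \subset 'N(K))) A.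
  by rewrite pAS.
by exists K.
Qed.

Hypothesis stab_neq : forall i j, i != j -> exists2 b, b \in B & b j = j /\ b i != i.
Hypothesis mod_max : forall K : {group gT}, maxnormal K S S ->
  forall u : wreath gT I, u.2 = 1 -> (forall i, u.1 i \in S) ->
  exists2 v, v \in H & v.2 = 1 /\ forall i, v.1 i * (u.1 i)^-1 \in K.

(** The image at o of the intersection of H with the base group is normal in S,
    because H induces all of S at o, and lies in no maximal normal subgroup. *)
Lemma mod_max_kern0 : S \subset coord o @* kern H set0.
Proof.
apply: contraT => notS.
have pr : coord o @* kern H set0 \proper S by rewrite properE coord_kern_sub.
have [K maxK sK] := sub_maxnormal pr coord_kern0_norm.
have [/andP[/properP[_ [s Ss notKs]] _] _] := maxgroupP maxK.
have [|i|v Hv [v1 vK]] := mod_max maxK (u := ([ffun=> s], 1)); rewrite ?ffunE //.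
have vo : v.1 o \in K.
  by apply: (subsetP sK); apply/kern_coordP; exists v => //; apply/kernP; split=> // j; rewrite inE.
by have := vK o; rewrite ffunE groupMl // groupV (negPf notKs).
Qed.

(** If the image at o of the elements trivial at j lay in a maximal normal K,
    the class modulo K of the label at o would be determined by the label at j.
    An element h of H fixing j and moving o to another point i transports this
    dependence to i.  It follows that, on the elements of H in the base group,
    a label in K at o forces a label in K at i, which contradicts the
    hypothesis modulo K, where the labels at o and i are independent. *)
Lemma mod_max_kern1 j : j != o -> S \subset coord o @* kern H [set j].
Proof.
move=> jo; apply: contraT => notS.
have pr : coord o @* kern H [set j] \proper S by rewrite properE coord_kern_sub.
have [K maxK sK] := sub_maxnormal pr (coord_kern1_norm j mod_max_kern0).
have [/andP[/properP[sKS [s Ss notKs]] nKS] _] := maxgroupP maxK.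
have [b Bb [bj bo]] : exists2 b, b \in B & b j = j /\ b o != o by apply: stab_neq; rewrite eq_sym.
have [h Hh hb] := H_top Bb.
have [|i|v Hv [v1 vK]] := mod_max maxK (u := ([ffun i => if i == b o then s else 1], 1)).
- by [].
- by rewrite ffunE; case: ifP.
have vo : v.1 o \in K by have := vK o; rewrite ffunE eq_sym (negPf bo) invg1 mulg1.
case/negP: notKs; have := vK (b o); rewrite ffunE eqxx => vbo.
suffices vboK : v.1 (b o) \in K by move: vbo; rewrite groupMl // groupV.
have vN : v \in kern H set0 by apply/kernP; split=> // i; rewrite inE.
(* v ^ h and v ^ g have the same label at j, so they agree modulo K at b o. *)
have /(subsetP (coord_kern0_trans j mod_max_kern0))/kern_coordP[g gN gj] := lab_in j Hh.
have [Hg g1 _] := kernP _ _ _ gN.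
(* h normalises the elements trivial at j, so these also have their label at b o in K. *)
have NbK u : u \in kern H [set j] -> u.1 (b o) \in K.
  move=> uN; have hN : h \in 'N(kern H [set j]).
    by apply: kern_norm => // i /set1P->; rewrite hb bj set11.
  have [_ u1 _] := kernP _ _ _ uN.
  have: u ^ h^-1 \in kern H [set j] by rewrite memJ_norm ?groupV.
  move=> u'N; have: coord o (u ^ h^-1) \in K.
    by apply: (subsetP sK); apply/kern_coordP; exists (u ^ h^-1).
  have [_ u'1 _] := kernP _ _ _ u'N.
  rewrite /coord => u'o; rewrite -(conjgKV h u) -hb lab_conj //.
  by rewrite memJ_norm ?(subsetP nKS) ?lab_in.
have /NbK : (v ^ h)^-1 * v ^ g \in kern H [set j].
  apply/kernP; split=> [||i /set1P->]; first by rewrite groupM ?groupV ?groupJ.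
    by rewrite topM topV !top_conj v1 !conj1g invg1 mulg1.
  rewrite labM labV !topV !top_conj v1 !conj1g !invg1 !perm1.
  have:= lab_conj h j v1; rewrite hb bj => ->.
  by have:= lab_conj g j v1; rewrite g1 perm1 gj => ->; rewrite mulVg.
rewrite labM labV !topV !top_conj v1 !conj1g !invg1 !perm1 -{1}hb lab_conj //.
have := lab_conj g (b o) v1; rewrite g1 perm1 => ->.
rewrite groupMl ?groupV; last by rewrite memJ_norm ?(subsetP nKS) ?lab_in.
by rewrite memJ_norm ?(subsetP nKS) ?lab_in.
Qed.

Theorem wreath_mod_max : H = wreath_group S B.
Proof.
apply: wreath_sub => //; apply: base_sub HS lift_trans _.
exact: kern_coord_onto S_perfect mod_max_kern0 mod_max_kern1.
Qed.

End Criterion.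

(** * Small generating sequences *)

Lemma gen2_mem (gT : finGroupType) (s t : gT) (G : {group gT}) :
  <<[set s; t]>> = G :> {set gT} -> s \in G /\ t \in G.
Proof. by move=> <-; split; apply: mem_gen; rewrite !inE eqxx ?orbT. Qed.

(** Each new generator at least doubles the order. *)
Lemma small_generating_seq (gT : finGroupType) (G : {group gT}) :
  exists Y : seq gT, <<[set y in Y]>> = G :> {set gT} /\ 2 ^ size Y <= #|G|.
Proof.
suffices: forall n (Y : seq gT), #|G| - #|<<[set y in Y]>>| <= n ->
    <<[set y in Y]>> \subset G -> 2 ^ size Y <= #|<<[set y in Y]>>| ->
    exists Y : seq gT, <<[set y in Y]>> = G :> {set gT} /\ 2 ^ size Y <= #|G|.
  move/(_ _ [::] (leqnn _)); apply; rewrite ?cardG_gt0 // gen_subG.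
  by apply/subsetP=> y; rewrite inE.
elim=> [|n IHn] Y le_n sYG leY.
  move: le_n; rewrite leqn0 subn_eq0 => leG; exists Y.
  have eqY: <<[set y in Y]>> = G :> {set gT} by apply/eqP; rewrite eqEcard sYG.
  by rewrite -{2}eqY.
have [sGY|/subsetPn[g Gg notYg]] := boolP (G \subset <<[set y in Y]>>).
  have eqY: <<[set y in Y]>> = G :> {set gT} by apply/eqP; rewrite eqEsubset sYG.
  by exists Y; rewrite -{2}eqY.
have sYgY : <<[set y in Y]>> \subset <<[set y in g :: Y]>>.
  by apply/genS/subsetP=> y; rewrite !inE => ->; rewrite orbT.
have pY : <<[set y in Y]>> \proper <<[set y in g :: Y]>>.
  apply/properP; split=> //; exists g => //.
  by apply: mem_gen; rewrite inE mem_head.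
apply: (IHn (g :: Y)).
- rewrite leq_subLR; move: le_n; rewrite leq_subLR addnS => /leq_trans; apply.
  by rewrite -addSn leq_add2r proper_card.
- rewrite gen_subG; apply/subsetP=> y; rewrite !inE => /orP[/eqP->//|Yy].
  by apply: (subsetP sYG); rewrite mem_gen ?inE.
rewrite /= expnS mulnC; apply: leq_trans (_ : #|<<[set y in Y]>>| * 2 <= _).
  by rewrite leq_mul2r leY.
rewrite -(Lagrange sYgY) leq_mul2l; apply/orP; right.
by rewrite indexg_gt1 proper_subn.
Qed.

(** * Products of labels along a cycle *)

Section CycleLabel.
Variables (gT : finGroupType) (I : finType) (x : {perm I}) (o : I).
Implicit Types a : {ffun I -> gT}.

(** The product of the labels along the x-cycle of o.  It is a label at o of an
    element of the point stabiliser of o, which is how a prescribed value of it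
    enters the image of that stabiliser. *)
Definition cycle_label a : gT := (((a, x) : wreath gT I) ^+ #|porbit x o|).1 o.

Lemma lab_pow_eq a a' k i : (forall j, j != o -> a j = a' j) -> o \notin traject x i k ->
  (((a, x) : wreath gT I) ^+ k).1 i = (((a', x) : wreath gT I) ^+ k).1 i.
Proof.
move=> eq_a; elim: k i => [|k IHk] i; first by rewrite !expg0.
rewrite inE negb_or eq_sym => /andP[/eq_a eq_i /IHk eq_k].
by rewrite !expgS !labM /= eq_i eq_k.
Qed.

(** The cycle starts at o and meets it only once, so the label at o occurs
    exactly once in the product, as its first factor. *)
Lemma cycle_label_head a a' : (forall j, j != o -> a j = a' j) ->
  (a o)^-1 * cycle_label a = (a' o)^-1 * cycle_label a'.
Proof.
move=> eq_a; rewrite /cycle_label; have := uniq_traject_porbit x o.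
case: #|_| (card_porbit_neq0 x o) => // l _ /= /andP[o_out _].
by rewrite !expgS !labM /= !mulKg (lab_pow_eq eq_a).
Qed.

Lemma cycle_label_inj a a' :
  (forall j, j != o -> a j = a' j) -> cycle_label a = cycle_label a' -> a o = a' o.
Proof.
by move=> /cycle_label_head eq_h eq_c; move: eq_h; rewrite eq_c => /mulIg eq_V; apply: invg_inj.
Qed.

Definition set_cycle_label s a : {ffun I -> gT} :=
  [ffun i => if i == o then s * (cycle_label a)^-1 * a o else a i].

Lemma set_cycle_label_off s a i : i != o -> set_cycle_label s a i = a i.
Proof. by rewrite ffunE => /negPf->. Qed.

Lemma cycle_label_set s a : cycle_label (set_cycle_label s a) = s.
Proof.
have := cycle_label_head (a := set_cycle_label s a) (a' := a) (fun j => @set_cycle_label_off s a j).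
move/(canRL (mulKVg _)); rewrite ffunE eqxx => ->.
by rewrite -mulgA mulKVg mulgKV.
Qed.

Lemma cycle_label_in (T : {group gT}) a : (forall i, a i \in T) -> cycle_label a \in T.
Proof.
move=> Ta; have: ((a, x) : wreath gT I) \in wreath_group T [group of setT].
  by apply/in_wreathP; split; rewrite ?inE.
by move/(groupX #|porbit x o|) => /in_wreathP[-> _].
Qed.

Lemma set_cycle_label_in (T : {group gT}) s a :
  s \in T -> (forall i, a i \in T) -> forall i, set_cycle_label s a i \in T.
Proof.
by move=> Ts Ta i; rewrite ffunE; case: ifP => _ //; rewrite !groupM ?groupV ?cycle_label_in.
Qed.

Lemma cycle_label_coord (H : {group wreath gT I}) a :
  ((a, x) : wreath gT I) \in H -> cycle_label a \in coord o @* (H :&: fixing gT o).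
Proof.
move=> Ha; set w : wreath gT I := (a, x).
have wo : w ^+ #|porbit x o| \in fixing gT o.
  rewrite inE; have ->: (w ^+ #|porbit x o|).2 = x ^+ #|porbit x o|.
    by elim: #|_| => // k IHk; rewrite !expgS topM IHk.
  by rewrite permX iter_porbit.
by apply: mem_morphim => //; rewrite inE wo groupX.
Qed.

End CycleLabel.

(** * Counting the labellings that do not generate *)

Section Count.
Variables (gT : finGroupType) (I : finType) (T : {group gT}) (B : {group {perm I}}).
Variables (x y z : {perm I}) (o : I) (s t : gT).
Hypothesis T_simple : simple T.
Hypothesis T_perfect : T^`(1) = T :> {set gT}.
Hypothesis T_gen : <<[set s; t]>> = T :> {set gT}.
Hypothesis B_gen : <<[set x; y; z]>> = B :> {set {perm I}}.
Hypothesis B_trans : forall i, exists2 b, b \in B & b o = i.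

Definition labelling : finType := ({ffun I -> gT} * {ffun I -> gT} * {ffun I -> gT})%type.
Implicit Types (l : labelling) (i j : I).

Definition labellings : {set labelling} :=
  [set l | [&& l.1.1 \in ffun_on T, l.1.2 \in ffun_on T & l.2 \in ffun_on T]].

Lemma labellingsP l :
  reflect [/\ forall i, l.1.1 i \in T, forall i, l.1.2 i \in T & forall i, l.2 i \in T]
          (l \in labellings).
Proof. by rewrite inE; apply: (iffP and3P) => -[]; do 3![move/ffun_onP=> ?]. Qed.

Lemma labelling_eq l l' : (forall i, l.1.1 i = l'.1.1 i) -> (forall i, l.1.2 i = l'.1.2 i) ->
  (forall i, l.2 i = l'.2 i) -> l = l'.
Proof.
by case: l l' => [[a b] c] [[a' b'] c'] /= /ffunP-> /ffunP-> /ffunP->.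
Qed.

Lemma card_labellings : #|labellings| = (#|T| ^ (3 * #|I|))%N.
Proof.
have ->: labellings = setX (setX [set f in ffun_on T] [set f in ffun_on T]) [set f in ffun_on T].
  by apply/setP=> -[[a b] c]; rewrite !inE andbA.
by rewrite !cardsX !cardsE !card_ffun_on -!expnD !mulSn mul0n addn0 addnA.
Qed.

Definition lift1 l : wreath gT I := (l.1.1, x).
Definition lift2 l : wreath gT I := (l.1.2, y).
Definition lift3 l : wreath gT I := (l.2, z).

Definition lifts l : {set wreath gT I} := <<[set lift1 l; lift2 l; lift3 l]>>.
Canonical lifts_group l := [group of lifts l].

Lemma lift_mem l : [/\ lift1 l \in lifts l, lift2 l \in lifts l & lift3 l \in lifts l].
Proof. by split; apply: mem_gen; rewrite !inE eqxx ?orbT. Qed.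

Lemma B_mem : [/\ x \in B, y \in B & z \in B].
Proof. by rewrite -B_gen; split; apply: mem_gen; rewrite !inE eqxx ?orbT. Qed.

Lemma lifts_sub l : l \in labellings -> lifts l \subset wreath_group T B.
Proof.
have [Bx By Bz] := B_mem; case/labellingsP=> Ta Tb Tc.
rewrite gen_subG; apply/subsetP=> w.
by case/setUP=> [/set2P[]|/set1P] ->; apply/in_wreathP.
Qed.

Lemma lifts_top l b : b \in B -> exists2 h, h \in lifts l & h.2 = b.
Proof.
have [L1 L2 L3] := lift_mem l.
pose top := [set h.2 | h : wreath gT I in lifts l].
suffices sBtop : B \subset top by move/(subsetP sBtop)/imsetP=> [h Hh ->]; exists h.
have gtop : group_set top.
  apply/group_setP; split; first by apply/imsetP; exists 1.
  move=> _ _ /imsetP[u Hu ->] /imsetP[v Hv ->]; apply/imsetP.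
  by exists (u * v); [rewrite groupM | rewrite topM].
rewrite -B_gen -[top]/(gval (Group gtop)) gen_subG; apply/subsetP=> w.
by case/setUP=> [/set2P[]|/set1P] ->; apply/imsetP;
  [exists (lift1 l)|exists (lift2 l)|exists (lift3 l)].
Qed.

Definition mover i : {perm I} := odflt 1 [pick b in B | b o == i].

Lemma moverP i : mover i \in B /\ mover i o = i.
Proof.
rewrite /mover; case: pickP => [b /andP[Bb /eqP]|] //.
by have [b Bb bo] := B_trans i; move/(_ b); rewrite Bb bo eqxx.
Qed.

(** First kind of failure: the lifts generate a complement of the base group. *)
Definition complemented : {set labelling} :=
  [set l in labellings | kern (lifts l) set0 == 1].

Definition lift_of l (b : {perm I}) : wreath gT I := odflt 1 [pick h in lifts l | h.2 == b].

Lemma lift_ofP l b : b \in B -> lift_of l b \in lifts l /\ (lift_of l b).2 = b.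
Proof.
rewrite /lift_of; case: pickP => [h /andP[Hh /eqP]|] //.
by move=> noh /(lifts_top l)[h Hh hb]; have:= noh h; rewrite Hh hb eqxx.
Qed.

Lemma lift_of_uniq l h : l \in complemented -> h \in lifts l -> lift_of l h.2 = h.
Proof.
rewrite inE => /andP[ll /eqP k1] Hh.
have Bh : h.2 \in B by have /in_wreathP[] := subsetP (lifts_sub ll) h Hh.
have [Hs s2] := lift_ofP l Bh.
apply/eqP; rewrite eq_mulgV1 -in_set1 -[[set 1]]k1; apply/kernP.
by split; rewrite ?groupM ?groupV //= ?s2 ?mulgV // => j; rewrite inE.
Qed.

Lemma lift_ofM l b b' : l \in complemented -> b \in B -> b' \in B ->
  lift_of l (b * b') = lift_of l b * lift_of l b'.
Proof.
move=> cl Bb Bb'; have [[Hs s2] [Hs' s2']] := (lift_ofP l Bb, lift_ofP l Bb').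
by rewrite -{1}s2 -{1}s2' -topM lift_of_uniq ?groupM.
Qed.

(** Reading the label at o of the unique lift of b is a homomorphism on the
    stabiliser of o and is multiplicative along the transversal; its values on
    generators of that stabiliser and on the transversal therefore determine
    it on B, and the label of x at i is a quotient of two of its values. *)
Lemma complemented_inj (Y : seq {perm I}) :
    <<[set b in Y]>> = 'C_B[o | 'P] :> {set {perm I}} ->
  {in complemented &, injective (fun l =>
     ([ffun i => (lift_of l (mover i)).1 o],
      [ffun k : 'I_(size Y) => (lift_of l (nth 1 Y k)).1 o]))}.
Proof.
move=> Y_gen l l' cl cl' [/ffunP eq_mover /ffunP eq_Y].
have YB b : b \in 'C_B[o | 'P] -> b \in B /\ b o = o.
  by case/setIP=> Bb /astab1P.
have lift_of1 l0 : l0 \in complemented -> lift_of l0 1 = 1.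
  by move=> cl0; have := lift_of_uniq cl0 (group1 _); rewrite top1.
pose E := [set b in 'C_B[o | 'P] | (lift_of l b).1 o == (lift_of l' b).1 o].
have labsM l0 b b' : l0 \in complemented -> b \in B -> b' \in B ->
    (lift_of l0 (b * b')).1 o = (lift_of l0 b).1 o * (lift_of l0 b').1 (b o).
  move=> cl0 Bb Bb'; rewrite lift_ofM // labM.
  by have [_ ->] := lift_ofP l0 Bb.
have gE : group_set E.
  apply/group_setP; split=> [|b b' /setIdP[Cb /eqP eq_b] /setIdP[Cb' /eqP eq_b']].
    by rewrite inE !lift_of1 // group1 eqxx.
  have [[Bb bo] [Bb' _]] := (YB b Cb, YB b' Cb').
  rewrite inE (groupM Cb Cb'); apply/eqP.
  by rewrite (labsM l _ _ cl Bb Bb') (labsM l' _ _ cl' Bb Bb') bo eq_b eq_b'.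
have sCE : 'C_B[o | 'P] \subset E.
  rewrite -Y_gen -[E]/(gval (Group gE)) gen_subG; apply/subsetP=> b; rewrite inE => Yb.
  rewrite inE -Y_gen mem_gen ?inE //=; apply/eqP.
  have ltb : index b Y < size Y by rewrite index_mem.
  by have := eq_Y (Ordinal ltb); rewrite !ffunE /= nth_index.
have eq_sec b : b \in B -> (lift_of l b).1 o = (lift_of l' b).1 o.
  move=> Bb; have [Bi bi] := moverP (b o).
  have b0E : b * (mover (b o))^-1 \in E.
    apply: (subsetP sCE); apply/setIP; split; first by rewrite groupM ?groupV.
    by apply/astab1P; rewrite /= /aperm permM -{2}bi permK.
  have [Cb0 /eqP eq_b0] := setIdP b0E; have [Bb0 b0o] := YB _ Cb0.
  have split_b l0 : l0 \in complemented -> (lift_of l0 b).1 o =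
      (lift_of l0 (b * (mover (b o))^-1)).1 o * (lift_of l0 (mover (b o))).1 o.
    by move=> cl0; have := labsM l0 _ _ cl0 Bb0 Bi; rewrite b0o mulgKV.
  rewrite (split_b l) // (split_b l') // eq_b0.
  by have := eq_mover (b o); rewrite !ffunE => ->.
have eq_lab b i : b \in B -> (lift_of l b).1 i = (lift_of l' b).1 i.
  move=> Bb; have [Bi bi] := moverP i.
  have := eq_sec _ (groupM Bi Bb).
  rewrite (labsM l _ _ cl Bi Bb) (labsM l' _ _ cl' Bi Bb) bi (eq_sec _ Bi).
  exact: mulgI.
have [Bx By Bz] := B_mem; have [[L1 L2 L3] [L1' L2' L3']] := (lift_mem l, lift_mem l').
have s1 : lift_of l x = lift1 l := lift_of_uniq cl L1.
have s2 : lift_of l y = lift2 l := lift_of_uniq cl L2.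
have s3 : lift_of l z = lift3 l := lift_of_uniq cl L3.
have s1' : lift_of l' x = lift1 l' := lift_of_uniq cl' L1'.
have s2' : lift_of l' y = lift2 l' := lift_of_uniq cl' L2'.
have s3' : lift_of l' z = lift3 l' := lift_of_uniq cl' L3'.
apply: labelling_eq => i.
- by have := eq_lab x i Bx; rewrite s1 s1'.
- by have := eq_lab y i By; rewrite s2 s2'.
- by have := eq_lab z i Bz; rewrite s3 s3'.
Qed.

Lemma card_complemented (Y : seq {perm I}) :
    <<[set b in Y]>> = 'C_B[o | 'P] :> {set {perm I}} ->
  #|complemented| <= #|T| ^ (#|I| + size Y).
Proof.
move=> Y_gen; rewrite -(card_in_imset (complemented_inj Y_gen)).
have CT l b : l \in complemented -> b \in B -> (lift_of l b).1 o \in T.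
  rewrite inE => /andP[ll _] Bb; have [Hs _] := lift_ofP l Bb.
  by have /in_wreathP[] := subsetP (lifts_sub ll) _ Hs.
have YB b : b \in Y -> b \in B.
  move=> Yb; have: b \in 'C_B[o | 'P] by rewrite -Y_gen mem_gen ?inE.
  by case/setIP.
pose C1 := [set f : {ffun I -> gT} in ffun_on T].
pose C2 := [set f : {ffun 'I_(size Y) -> gT} in ffun_on T].
apply: leq_trans (_ : #|setX C1 C2| <= _); last first.
  by rewrite cardsX !cardsE !card_ffun_on card_ord expnD.
apply/subset_leq_card/subsetP=> _ /imsetP[l cl ->]; rewrite !inE /=.
apply/andP; split; apply/ffun_onP=> i; rewrite ffunE CT //.
  by have [] := moverP i.
by rewrite YB ?mem_nth.
Qed.

(** Second kind of failure: the intersection with the base group induces T at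
    each point, but the coordinate at o is not independent of another one. *)
Definition linked : {set labelling} :=
  [set l in labellings | (T \subset coord o @* kern (lifts l) set0) &&
    [exists j, (j != o) && ~~ (T \subset coord o @* kern (lifts l) [set j])]].

(** These are the only failures: when the lifts induce T at o, the image at o
    of the base part is normal in the simple group T. *)
Lemma lifts_eq_wreath l : l \in labellings -> T \subset coord o @* (lifts l :&: fixing gT o) ->
  l \notin complemented -> l \notin linked -> lifts l = wreath_group T B.
Proof.
move=> ll onto; rewrite in_set ll /= => notC; rewrite in_set ll /= => notL.
have HT := lifts_sub ll; have Htop := @lifts_top l.
have onto0 : T \subset coord o @* kern (lifts l) set0.
  have [_ T_min] := simpleP _ T_simple.
  have nN : coord o @* kern (lifts l) set0 <| T.
    by rewrite /normal (coord_kern_sub HT) (coord_kern0_norm onto).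
  have [N1|->//] := T_min _ nN.
  case/negP: notC; apply/eqP/trivgP/subsetP=> u uN; have [Hu u1 _] := kernP _ _ _ uN.
  rewrite inE; apply/eqP/wreathP => // i; rewrite lab1.
  have [h Hh <-] := lift_trans Htop B_trans i.
  have: u ^ h^-1 \in kern (lifts l) set0.
    by rewrite memJ_norm ?groupV // (subsetP (norm_kern0 _)).
  move=> u'N; have [_ u'1 _] := kernP _ _ _ u'N.
  rewrite -(conjgKV h u) lab_conj //; suffices ->: (u ^ h^-1).1 o = 1 by rewrite conj1g.
  by apply/set1P; rewrite -[[set 1]]N1; apply/kern_coordP; exists (u ^ h^-1).
congr (gval _); apply: (@wreath_sub _ _ T B (lifts_group l)) => //.
apply: base_sub HT (lift_trans Htop B_trans) _.
apply: kern_coord_onto => // j jo; apply: contraR notL => notj.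
by rewrite onto0; apply/existsP; exists j; rewrite jo.
Qed.

(** For a linked labelling, this equivalence says that the two coordinates of
    the base part are related by an automorphism of T. *)
Definition covanish l i i' : bool :=
  [forall u in kern (lifts l) set0, (u.1 i == 1) == (u.1 i' == 1)].

Lemma covanishP l i i' :
  reflect (forall u, u \in kern (lifts l) set0 -> (u.1 i == 1) = (u.1 i' == 1)) (covanish l i i').
Proof. by apply: (iffP forall_inP) => eqi u /eqi => [/eqP|->]. Qed.

Lemma covanish_refl l i : covanish l i i.
Proof. exact/covanishP. Qed.

Lemma covanish_sym l i i' : covanish l i i' -> covanish l i' i.
Proof. by move/covanishP=> eqi; apply/covanishP=> u /eqi. Qed.

Lemma covanish_trans l i i' i'' : covanish l i i' -> covanish l i' i'' -> covanish l i i''.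
Proof. by move=> /covanishP e1 /covanishP e2; apply/covanishP=> u uN; rewrite e1 ?e2. Qed.

Lemma covanish_conj l h i i' : h \in lifts l -> covanish l i i' -> covanish l (h.2 i) (h.2 i').
Proof.
move=> Hh /covanishP e; apply/covanishP=> u uN.
have u'N: u ^ h^-1 \in kern (lifts l) set0.
  by rewrite memJ_norm ?groupV // (subsetP (norm_kern0 _)).
have [_ u'1 _] := kernP _ _ _ u'N.
by rewrite -(conjgKV h u) !lab_conj // !conjg_eq1 e.
Qed.

Lemma linked_onto l i g : l \in linked -> g \in T ->
  exists2 u, u \in kern (lifts l) set0 & u.1 i = g.
Proof.
rewrite inE => /and3P[ll onto0 _] Tg.
apply/kern_coordP.
exact: (subsetP (coord_kern0_trans (lifts_sub ll) (@lifts_top l) B_trans i onto0)).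
Qed.

(** The image at o of the elements trivial at j is a proper normal subgroup
    of T, hence trivial; the same argument then applies with o and j exchanged,
    since otherwise the image at o of the whole base part would be trivial. *)
Lemma linked_covanish l : l \in linked -> exists2 j, j != o & covanish l o j.
Proof.
move=> Ll; have:= Ll; rewrite inE => /and3P[ll onto0 /existsP[j /andP[jo notj]]].
exists j => //; have HT := lifts_sub ll; have [T_neq1 T_min] := simpleP _ T_simple.
have ontoj := coord_kern0_trans HT (@lifts_top l) B_trans j onto0.
have trivo : coord o @* kern (lifts l) [set j] = 1.
  case: (T_min [group of coord o @* kern (lifts l) [set j]]) => // [|eqT].
    by rewrite /normal (coord_kern_sub HT) coord_kern1_norm.
  by rewrite -eqT subxx in notj.
have jK u : u \in kern (lifts l) set0 -> u.1 j = 1 -> u.1 o = 1.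
  move=> /kernP[Hu u1 _] uj; apply/set1P; rewrite -[[set 1]]trivo; apply/kern_coordP.
  by exists u => //; apply/kernP; split=> // i /set1P->.
have trivj : coord j @* kern (lifts l) [set o] = 1.
  case: (T_min [group of coord j @* kern (lifts l) [set o]]) => // [|eqT].
    by rewrite /normal (coord_kern_sub HT) coord_kern1_norm.
  case/negP: T_neq1; rewrite -subG1; apply/subsetP=> g Tg; rewrite inE; apply/eqP.
  have [u uN <-] := linked_onto o Ll Tg; have [Hu u1 _] := kernP _ _ _ uN.
  have: u.1 j \in T by have /in_wreathP[] := subsetP HT u Hu.
  rewrite -{1}eqT => /kern_coordP[v /kernP[Hv v1 vo] vj].
  have: (v^-1 * u).1 o = 1.
    apply: jK.
      apply/kernP; rewrite groupM ?groupV // topM topV v1 u1 invg1 mulg1.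
      by split=> // i; rewrite inE.
    by rewrite labM labV topV v1 invg1 !perm1 vj mulVg.
  by rewrite labM labV topV v1 invg1 !perm1 vo ?set11 // invg1 mul1g.
apply/covanishP=> u uN; apply/eqP/eqP; last exact: jK.
have [Hu u1 _] := kernP _ _ _ uN.
move=> uo; apply/set1P; rewrite -[[set 1]]trivj; apply/kern_coordP.
by exists u => //; apply/kernP; split=> // i /set1P->.
Qed.

(** The equivalence is invariant under B, so the class D of o determines all the
    classes: the class of i is the translate of D by any element moving o to i.
    This is why a subset of I is enough to encode the partition. *)
Definition covanish_class l : {set I} := [set i | covanish l o i].
Definition block (D : {set I}) i : {set I} := mover i @: D.
Definition rep (D : {set I}) i : I := odflt i [pick i' in block D i].

Lemma in_block l i i' : (i' \in block (covanish_class l) i) = covanish l i i'.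
Proof.
have [Bi bi] := moverP i; have [h Hh hb] := lifts_top l Bi.
apply/imsetP/idP=> [[k] | ii'].
  rewrite inE => ok ->; rewrite -{1}bi -hb; exact: covanish_conj.
exists ((mover i)^-1 i'); last by rewrite permKV.
by rewrite inE -{1}(permK (mover i) o) bi -hb -topV covanish_conj ?groupV.
Qed.

Lemma covanish_rep l i : covanish l i (rep (covanish_class l) i).
Proof.
rewrite /rep; case: pickP => [i'|_]; last exact: covanish_refl.
by rewrite in_block.
Qed.

Lemma rep_eq l i i' : covanish l i i' -> rep (covanish_class l) i = rep (covanish_class l) i'.
Proof.
move=> ii'; rewrite /rep.
have ->: block (covanish_class l) i = block (covanish_class l) i'.
  apply/setP=> k; rewrite !in_block; apply/idP/idP; last exact: covanish_trans.
  exact: covanish_trans (covanish_sym ii').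
by case: pickP => // /(_ i'); rewrite in_block covanish_refl.
Qed.

Lemma rep_idem l i : rep (covanish_class l) (rep (covanish_class l) i) = rep (covanish_class l) i.
Proof. by rewrite -(rep_eq (covanish_rep l i)). Qed.

Definition reps (D : {set I}) : {set I} := [set i | rep D i == i].

(** Every class contains the translate of a pair of equivalent points, hence has
    at least two elements. *)
Lemma card_reps l : l \in linked -> (2 * #|reps (covanish_class l)| <= #|I|)%N.
Proof.
move=> Ll; have other i : exists i', covanish l i i' && (i' != i).
  have [j jo oj] := linked_covanish Ll; have [Bi bi] := moverP i.
  have [h Hh hb] := lifts_top l Bi.
  exists (mover i j); apply/andP; split; first by have := covanish_conj Hh oj; rewrite hb bi.
  by apply: contra jo => /eqP e; rewrite -(inj_eq (@perm_inj _ (mover i))) bi e.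
pose f i := xchoose (other i).
have fP i : covanish l i (f i) /\ f i != i by have /andP[] := xchooseP (other i).
have f_inj : {in reps (covanish_class l) &, injective f}.
  move=> i i'; rewrite !inE => /eqP ri /eqP ri' eq_f.
  by rewrite -ri -ri' (rep_eq (fP i).1) eq_f -(rep_eq (fP i').1).
rewrite mul2n -addnn -{1}(card_in_imset f_inj) addnC -(cardsC (reps (covanish_class l))) leq_add2l.
apply/subset_leq_card/subsetP=> k /imsetP[i ir ->]; move: ir; rewrite !inE => /eqP ri.
by rewrite -(rep_eq (fP i).1) ri eq_sym; case: (fP i).
Qed.

(** The value at i of the base elements of value g at the representative of i:
    the image of g under the automorphism relating the two coordinates. *)
Definition forced l g i : gT :=
  (odflt 1 [pick u in kern (lifts l) set0 | u.1 (rep (covanish_class l) i) == g]).1 i.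

Lemma forcedP l g i u : l \in linked -> u \in kern (lifts l) set0 ->
  u.1 (rep (covanish_class l) i) = g -> u.1 i = forced l g i.
Proof.
move=> Ll uN ug; rewrite /forced; case: pickP => [v /andP[vN /eqP vg]|/(_ u)]; last first.
  by rewrite uN ug eqxx.
have [[Hu u1 _] [Hv v1 _]] := (kernP _ _ _ uN, kernP _ _ _ vN).
have uvN : u * v^-1 \in kern (lifts l) set0 by rewrite groupM ?groupV.
have /covanishP/(_ _ uvN) := covanish_rep l i.
by rewrite !labM !labV v1 u1 invg1 !perm1 -!eq_mulgV1 ug vg eqxx => /eqP.
Qed.

Lemma centerless w w' : w \in T -> w' \in T -> (forall v, v \in T -> v ^ w = v ^ w') -> w = w'.
Proof.
move=> Tw Tw' eq_w; have [T_neq1 T_min] := simpleP _ T_simple.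
have Z1 : 'Z(T) = 1.
  case: (T_min _ (center_normal T)) => // ZT; case/eqP: T_neq1.
  by rewrite -T_perfect; apply/derG1P/center_idP.
apply/eqP; rewrite eq_mulVg1 -in_set1 -[[set 1]]Z1; apply/centerP.
rewrite groupM ?groupV //; split=> // v Tv.
have := eq_w (v ^ w^-1); rewrite groupJ ?groupV // conjgKV -conjgM => /(_ isT) ev.
by apply/commute_sym/commgP/conjg_fixP/esym.
Qed.

(** Two linked labellings with the same class of o and the same images of s and t
    induce the same automorphisms, because s and t generate T.  Conjugation by
    the lift of a generator then shows that its label at i is determined, up to
    the trivial centre of T, by its label at the representative of i. *)
Section Agree.
Variables l l' : labelling.
Hypotheses (Ll : l \in linked) (Ll' : l' \in linked).
Hypothesis (eq_class : covanish_class l = covanish_class l').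
Hypothesis eq_s : forall i, forced l s i = forced l' s i.
Hypothesis eq_t : forall i, forced l t i = forced l' t i.
Local Notation r := (rep (covanish_class l)).

Lemma lab_agree i u u' :
    u \in kern (lifts l) set0 -> u' \in kern (lifts l') set0 ->
  u.1 (r i) = u'.1 (r i) -> u.1 i = u'.1 i.
Proof.
pose E := [set g in T | [forall v in kern (lifts l) set0, forall v' in kern (lifts l') set0,
  (v.1 (r i) == g) ==> (v'.1 (r i) == g) ==> (v.1 i == v'.1 i)]].
have EP g v v' : g \in E -> v \in kern (lifts l) set0 -> v' \in kern (lifts l') set0 ->
    v.1 (r i) = g -> v'.1 (r i) = g -> v.1 i = v'.1 i.
  rewrite inE => /andP[_ /forall_inP Eg] Nv Nv' /eqP vg /eqP v'g.
  by have /forall_inP/(_ _ Nv') := Eg v Nv; rewrite vg v'g => /eqP.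
have inE_ g : g \in T -> (forall v v', v \in kern (lifts l) set0 -> v' \in kern (lifts l') set0 ->
    v.1 (r i) = g -> v'.1 (r i) = g -> v.1 i = v'.1 i) -> g \in E.
  move=> Tg Eg; rewrite inE Tg; apply/forall_inP=> v Nv; apply/forall_inP=> v' Nv'.
  by apply/implyP=> /eqP vg; apply/implyP=> /eqP v'g; apply/eqP/Eg.
have gE : group_set E.
  apply/group_setP; split=> [|g1 g2 E1 E2].
    apply: inE_ => // v v' Nv Nv' v1 v'1; apply: etrans (_ : 1 = _).
      by apply/eqP; have /covanishP/(_ _ Nv)-> := covanish_rep l i; rewrite v1.
    apply/esym/eqP; have /covanishP/(_ _ Nv')-> := covanish_rep l' i.
    by rewrite -eq_class v'1.
  have [[T1 _] [T2 _]] := (setIdP E1, setIdP E2).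
  apply: inE_ => [|v v' Nv Nv' vg v'g]; first by rewrite groupM.
  have [v1 Nv1 v1g] := linked_onto (r i) Ll T1.
  have [v1' Nv1' v1'g] := linked_onto (r i) Ll' T1.
  have [[_ t1 _] [_ t1' _]] := (kernP _ _ _ Nv1, kernP _ _ _ Nv1').
  have /EP/(_ Nv1 Nv1' v1g v1'g) e1 := E1.
  have := EP _ (v1^-1 * v) (v1'^-1 * v') E2; rewrite !labM !labV !topV t1 t1' !invg1 !perm1.
  rewrite v1g v1'g vg v'g !mulKg e1 !groupM ?groupV // => /(_ isT isT erefl erefl).
  exact: mulgI.
have TE : T \subset E.
  have [Ts Tt] := gen2_mem T_gen.
  rewrite -T_gen -[E]/(gval (Group gE)) gen_subG; apply/subsetP=> g.
  case/set2P=> ->; apply: inE_ => // v v' Nv Nv' vg v'g.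
    by rewrite (forcedP Ll Nv vg) eq_s; apply/esym/forcedP; rewrite // -eq_class.
  by rewrite (forcedP Ll Nv vg) eq_t; apply/esym/forcedP; rewrite // -eq_class.
move=> Nu Nu' eq_u; apply: (EP (u.1 (r i))) => //; apply: (subsetP TE).
have := Ll; rewrite inE => /andP[ll _]; have [Hu _ _] := kernP _ _ _ Nu.
by have /in_wreathP[] := subsetP (lifts_sub ll) u Hu.
Qed.

Lemma lab_agree_rep i u u' :
    u \in kern (lifts l) set0 -> u' \in kern (lifts l') set0 ->
  u.1 i = u'.1 i -> u.1 (r i) = u'.1 (r i).
Proof.
move=> Nu Nu' eq_u; have := Ll; rewrite inE => /andP[ll _]; have [Hu u1 _] := kernP _ _ _ Nu.
have Tu : u.1 (r i) \in T by have /in_wreathP[] := subsetP (lifts_sub ll) u Hu.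
have [v Nv vr] := linked_onto (r i) Ll' Tu; have [_ v1 _] := kernP _ _ _ Nv.
have [_ u1' _] := kernP _ _ _ Nu'.
have vi : v.1 i = u'.1 i by rewrite -eq_u; apply/esym/lab_agree.
have /covanishP/(_ (v^-1 * u')) := covanish_rep l' i; rewrite groupM ?groupV // => /(_ isT).
rewrite !labM !labV !topV v1 !invg1 !perm1 vi mulVg eqxx -eq_class => /esym.
by rewrite -eq_mulVg1 vr => /eqP.
Qed.

Lemma gen_agree h h' : h \in lifts l -> h' \in lifts l' -> h.2 = h'.2 ->
  (forall j, j \in reps (covanish_class l) -> h.1 j = h'.1 j) -> forall i, h.1 i = h'.1 i.
Proof.
move=> Hh Hh' eq2 eq_reps i.
have lab_T l0 h0 j : l0 \in linked -> h0 \in lifts l0 -> h0.1 j \in T.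
  rewrite inE => /andP[ll _] Hh0.
  by have /in_wreathP[] := subsetP (lifts_sub ll) h0 Hh0.
apply: centerless (lab_T _ _ i Ll Hh) (lab_T _ _ i Ll' Hh') _ => v Tv.
have [u Nu ui] := linked_onto i Ll Tv; have [Hu u1 _] := kernP _ _ _ Nu.
have [u' Nu' ur'] := linked_onto (r i) Ll' (lab_T _ _ (r i) Ll Hu).
have [Hu' u1' _] := kernP _ _ _ Nu'.
have ui' : u'.1 i = v by rewrite -ui; apply/esym/lab_agree.
have NJ : u ^ h \in kern (lifts l) set0 by rewrite memJ_norm // (subsetP (norm_kern0 _)).
have NJ' : u' ^ h' \in kern (lifts l') set0 by rewrite memJ_norm // (subsetP (norm_kern0 _)).
have eq_hr : h.1 (r i) = h'.1 (r i) by apply: eq_reps; rewrite inE rep_idem.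
have <-: (u ^ h).1 (h.2 i) = v ^ h.1 i by rewrite lab_conj // ui.
have <-: (u' ^ h').1 (h.2 i) = v ^ h'.1 i by rewrite eq2 lab_conj // ui'.
apply: lab_agree => //; rewrite (rep_eq (covanish_conj Hh (covanish_rep l i))).
by apply: lab_agree_rep => //; rewrite lab_conj // eq2 lab_conj // ur' eq_hr.
Qed.
End Agree.

(** The labels at the representatives, and elsewhere the images of s and t under
    the automorphisms; the third component records nothing off the representatives. *)
Definition code l : labelling :=
  ([ffun i => if i \in reps (covanish_class l) then l.1.1 i else forced l s i],
   [ffun i => if i \in reps (covanish_class l) then l.1.2 i else forced l t i],
   [ffun i => if i \in reps (covanish_class l) then l.2 i else 1]).

Lemma forced_reps l g i :
  l \in linked -> g \in T -> i \in reps (covanish_class l) -> forced l g i = g.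
Proof.
move=> Ll Tg; rewrite inE => /eqP ri; have [u Nu ug] := linked_onto i Ll Tg.
by rewrite -{2}ug; apply/esym/forcedP; rewrite ?ri.
Qed.

Lemma code_inj D : {in [set l in linked | covanish_class l == D] &, injective code}.
Proof.
move=> l l' /setIdP[Ll /eqP cl] /setIdP[Ll' /eqP cl'] [/ffunP e1 /ffunP e2 /ffunP e3].
have [Ts Tt] := gen2_mem T_gen; have eqc : covanish_class l = covanish_class l' by rewrite cl.
have eq_s i : forced l s i = forced l' s i.
  have [ri|nri] := boolP (i \in reps (covanish_class l)); first by rewrite !forced_reps // -?eqc.
  by have := e1 i; rewrite !ffunE -eqc (negPf nri).
have eq_t i : forced l t i = forced l' t i.
  have [ri|nri] := boolP (i \in reps (covanish_class l)); first by rewrite !forced_reps // -?eqc.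
  by have := e2 i; rewrite !ffunE -eqc (negPf nri).
have [[L1 L2 L3] [L1' L2' L3']] := (lift_mem l, lift_mem l').
apply: labelling_eq.
- apply: (gen_agree Ll Ll' eqc eq_s eq_t L1 L1') => // j rj.
  by have := e1 j; rewrite !ffunE -eqc rj.
- apply: (gen_agree Ll Ll' eqc eq_s eq_t L2 L2') => // j rj.
  by have := e2 j; rewrite !ffunE -eqc rj.
- apply: (gen_agree Ll Ll' eqc eq_s eq_t L3 L3') => // j rj.
  by have := e3 j; rewrite !ffunE -eqc rj.
Qed.

Lemma card_linked_class D :
  #|[set l in linked | covanish_class l == D]| <= #|T| ^ (2 * #|I| + #|I|./2).
Proof.
have [->|[l0 /setIdP[Ll0 /eqP cD]]] := set_0Vmem [set l in linked | covanish_class l == D].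
  by rewrite cards0.
have leR : #|reps D| <= #|I|./2.
  by rewrite -(doubleK #|reps D|) half_leq // -mul2n -cD card_reps.
rewrite -(card_in_imset (@code_inj D)).
pose C1 := [set f : {ffun I -> gT} in ffun_on T].
pose C3 := [set f : {ffun I -> gT} in pffun_on 1 (mem (reps D)) (mem T)].
apply: leq_trans (_ : #|setX (setX C1 C1) C3| <= _); last first.
  rewrite !cardsX !cardsE !card_ffun_on card_pffun_on -!expnD addnn -mul2n.
  by rewrite leq_pexp2l ?cardG_gt0 // leq_add2l.
apply/subset_leq_card/subsetP=> k /imsetP[l /setIdP[Ll /eqP cl] ->].
have [Ts Tt] := gen2_mem T_gen.
have forcedT g i : g \in T -> forced l g i \in T.
  move=> Tg; have [u Nu ug] := linked_onto (rep (covanish_class l) i) Ll Tg.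
  rewrite -(forcedP Ll Nu ug); have := Ll; rewrite inE => /andP[ll _].
  have [Hu _ _] := kernP _ _ _ Nu.
  by have /in_wreathP[] := subsetP (lifts_sub ll) u Hu.
have := Ll; rewrite inE => /andP[/labellingsP[T1 T2 T3] _].
rewrite !inE /= -andbA; apply/and3P; split.
- by apply/ffun_onP=> i; rewrite ffunE; case: ifP => _; rewrite ?forcedT.
- by apply/ffun_onP=> i; rewrite ffunE; case: ifP => _; rewrite ?forcedT.
apply/pffun_onP; split.
  by apply/supportP=> i; rewrite ffunE cl => /negPf->.
move=> g /imageP[i ri ->]; rewrite ffunE cl; case: ifP => _ //; exact: T3.
Qed.

Lemma card_linked : #|linked| <= 2 ^ #|I| * #|T| ^ (2 * #|I| + #|I|./2).
Proof.
have ->: #|linked| = \sum_(D : {set I}) #|[set l in linked | covanish_class l == D]|.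
  rewrite -sum1_card (partition_big covanish_class predT) //=; apply: eq_bigr => D _.
  by rewrite -sum1_card; apply: eq_bigl => l; rewrite !inE.
apply: leq_trans (_ : \sum_(D : {set I}) #|T| ^ (2 * #|I| + #|I|./2) <= _).
  by apply: leq_sum => D _; apply: card_linked_class.
have card2 : #|{set I}| = (2 ^ #|I|)%N.
  rewrite -[#|I|]cardsT -card_powerset -cardsT; congr #|pred_of_set _|.
  by apply/setP=> D; rewrite !inE subsetT.
by rewrite sum_nat_const card2.
Qed.

End Count.

(** At h = 14 this amounts to 2 ^ 17 <= 3 ^ 11. *)
Lemma exp4_le_exp6 h : 14 <= h -> 4 ^ h <= 6 ^ (h - 3).
Proof.
move=> /subnKC <-; move: (h - 14)%N => k; rewrite -addnBAC // !expnD.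
apply: leq_mul; last by case: k => // k; rewrite leq_exp2r.
have ->: (4 ^ 14 = 2 ^ 11 * (2 ^ 6 * 2 ^ 11))%N by rewrite -(expnM 2 2 14) -!expnD.
have ->: (6 ^ 11 = 3 ^ 7 * (3 ^ 4 * 2 ^ 11))%N.
  by rewrite mulnA -expnD -expnMn.
by apply: leq_mul => //; apply: leq_mul.
Qed.

(** * Generating labellings for a simple group *)

Section Existence.
Variables (gT : finGroupType) (I : finType) (T : {group gT}) (B : {group {perm I}}).
Variables (x y z : {perm I}) (o : I) (s t : gT).
Hypothesis T_simple : simple T.
Hypothesis T_perfect : T^`(1) = T :> {set gT}.
Hypothesis T_gen : <<[set s; t]>> = T :> {set gT}.
Hypothesis B_gen : <<[set x; y; z]>> = B :> {set {perm I}}.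
Hypothesis B_trans : forall i, exists2 b, b \in B & b o = i.
Hypothesis I_large : 27 <= #|I|.
Hypothesis B_small : #|B| <= 2 ^ (2 * #|I| - 3).

(** The groups of order at most 5 are abelian. *)
Lemma perfect_card_ge6 : 6 <= #|T|.
Proof.
have [T_neq1 _] := simpleP _ T_simple.
have notab : ~~ abelian T.
  by apply: contra T_neq1 => /derG1P; rewrite T_perfect => ->.
rewrite leqNgt; apply: contra notab; rewrite ltnS => leT.
have := leT; rewrite leq_eqVlt => /orP[/eqP c5|].
  by apply/cyclic_abelian/prime_cyclic; rewrite c5.
rewrite ltnS leq_eqVlt => /orP[/eqP c4|].
  by apply: (@p2group_abelian _ 2); rewrite /pgroup c4.
rewrite ltnS leq_eqVlt => /orP[/eqP c3|].
  by apply/cyclic_abelian/prime_cyclic; rewrite c3.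
rewrite ltnS leq_eqVlt => /orP[/eqP c2|].
  by apply/cyclic_abelian/prime_cyclic; rewrite c2.
by rewrite ltnS -trivg_card_le1 (negPf T_neq1).
Qed.

(** Overwriting the labels of a and b at o so as to satisfy the cycle conditions
    identifies at most #|T| ^ 2 labellings.  If all the results were bad, the
    #|T| ^ (3 * #|I|) labellings would be at most 2 * #|T| ^ (3 * #|I| - 1). *)
Lemma simple_generating_labelling : exists a b c : {ffun I -> gT},
  [/\ (forall i, a i \in T) /\ (forall i, b i \in T) /\ (forall i, c i \in T),
      cycle_label x o a = s, cycle_label y o b = t &
      <<[set ((a, x) : wreath gT I); (b, y); (c, z)]>> = wreath_group T B :> {set _}].
Proof.
have [Ts Tt] := gen2_mem T_gen; have q6 := perfect_card_ge6.
pose norm (l : labelling gT I) : labelling gT I :=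
  (set_cycle_label x o s l.1.1, set_cycle_label y o t l.1.2, l.2).
have norm_in l : l \in labellings I T -> norm l \in labellings I T.
  by case/labellingsP=> Ta Tb Tc; apply/labellingsP; split=> //= i; apply: set_cycle_label_in.
pose bad := complemented T x y z :|: linked T x y z o.
have [/existsP[l /andP[ll good]]|/existsPn allbad] :=
    boolP [exists l, (l \in labellings I T) && (norm l \notin bad)].
  have /labellingsP[Ta Tb Tc] := norm_in l ll.
  exists (norm l).1.1, (norm l).1.2, (norm l).2; rewrite !cycle_label_set; split=> //.
  move: good; rewrite in_setU negb_or => /andP[good1 good2].
  apply: (lifts_eq_wreath T_simple T_perfect B_gen B_trans (norm_in l ll)) => //.
  have [L1 L2 _] := lift_mem x y z (norm l).
  rewrite -{1}T_gen gen_subG; apply/subsetP=> g /set2P[] ->.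
    rewrite -(cycle_label_set x o s l.1.1).
    exact: (@cycle_label_coord _ _ _ _ (lifts_group x y z (norm l)) _ L1).
  rewrite -(cycle_label_set y o t l.1.2).
  exact: (@cycle_label_coord _ _ _ _ (lifts_group x y z (norm l)) _ L2).
have [Y [Y_gen leY]] := small_generating_seq [group of 'C_B[o | 'P]].
have sizeY : size Y <= 2 * #|I| - 3.
  rewrite -(@leq_exp2l 2) //. apply: (leq_trans leY); apply: (leq_trans _ B_small).
  exact: subset_leq_card (subsetIl _ _).
have q_gt0 : 0 < #|T| := cardG_gt0 T.
have le_comp : #|complemented T x y z| <= #|T| ^ (3 * #|I| - 3).
  apply: leq_trans (card_complemented T B_gen B_trans Y_gen) _.
  rewrite leq_pexp2l //; apply: leq_trans (leq_add (leqnn _) sizeY) _.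
  by move: I_large; case: #|I| => // n; lia.
have le_link : #|linked T x y z o| <= #|T| ^ (3 * #|I| - 3).
  apply: leq_trans (card_linked T_simple T_perfect T_gen B_gen B_trans) _.
  set h := (#|I| - #|I|./2)%N; have h14 : 14 <= h by rewrite /h; lia.
  have -> : (3 * #|I| - 3 = (h - 3) + (2 * #|I| + #|I|./2))%N by rewrite /h; lia.
  rewrite [X in _ <= X]expnD leq_mul2r; apply/orP; right.
  apply: leq_trans (_ : 4 ^ h <= _).
    by rewrite -[4]/(2 ^ 2)%N -expnM leq_exp2l // /h; lia.
  apply: leq_trans (exp4_le_exp6 h14) _; rewrite leq_exp2r // subn_gt0.
  exact: leq_trans h14.
pose f (l : labelling gT I) := (norm l, (l.1.1 o, l.1.2 o)).
have f_inj : injective f.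
  move=> l l' [/ffunP e1 /ffunP e2 e3 e4 e5]; apply: labelling_eq => i; last by rewrite e3.
    by have [->|io] := eqVneq i o; [|have := e1 i; rewrite !set_cycle_label_off].
  by have [->|io] := eqVneq i o; [|have := e2 i; rewrite !set_cycle_label_off].
have: #|f @: labellings I T| <= #|setX bad (setX T T)|.
  apply/subset_leq_card/subsetP=> k /imsetP[l ll ->].
  have [Ta Tb Tc] := labellingsP _ _ ll.
  by have := allbad l; rewrite ll negbK => badl; rewrite !in_setX badl /= Ta Tb.
rewrite card_imset // card_labellings !cardsX leqNgt => /negP[].
apply: leq_ltn_trans (_ : (#|T| ^ (3 * #|I| - 3) * 2) * (#|T| * #|T|) < _).
  by rewrite leq_mul2r muln2 -addnn (leq_trans (leq_card_setU _ _)) ?orbT // leq_add.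
have -> : (3 * #|I| = (3 * #|I| - 3) + 3)%N by lia.
rewrite addnK expnD -mulnA ltn_pmul2l ?expn_gt0 ?q_gt0 // [(_ ^ 3)%N]/(#|T| * (#|T| * #|T|))%N.
by rewrite ltn_pmul2r ?muln_gt0 ?q_gt0 // (leq_trans _ q6).
Qed.
End Existence.

(** * Independence of the maximal normal subgroups of a perfect group *)

Section Chinese.
Variables (gT : finGroupType) (S : {group gT}).
Hypothesis S_perfect : S^`(1) = S :> {set gT}.
Implicit Types K A : {group gT}.

Lemma maxnormal_normal K : maxnormal K S S -> K <| S.
Proof.
by case/maxgroupP=> /andP[/proper_sub sKS nKS] _; rewrite /normal sKS.
Qed.

(** Modulo K, the commutator of A1 and A2 is the commutator of S with itself. *)
Lemma perfect_cap_cover K A1 A2 : K <| S -> A1 <| S -> A2 <| S ->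
  S \subset K * A1 -> S \subset K * A2 -> S \subset K * (A1 :&: A2).
Proof.
move=> /andP[_ nKS] /andP[s1 n1] /andP[s2 n2].
rewrite -!quotientSK // => c1 c2.
apply: subset_trans (_ : [~: A1, A2] / K \subset _).
  rewrite quotientR ?(subset_trans s1) ?(subset_trans s2) //.
  by rewrite -{1}S_perfect quotientR // commgSS.
apply: quotientS; rewrite subsetI commg_subl commg_subr.
by rewrite (subset_trans s2) // (subset_trans s1).
Qed.

Lemma maxnormal_cover K K' : maxnormal K S S -> maxnormal K' S S -> K != K' ->
  S \subset K * K'.
Proof.
move=> mK mK' neq; have nK := maxnormal_normal mK; have nK' := maxnormal_normal mK'.
have [_ maxK] := maxgroupP mK; have [_ maxK'] := maxgroupP mK'.
have nKK' : K <*> K' <| S by rewrite normalY.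
have eqj : K <*> K' = (K * K')%g.
  by rewrite norm_joinEr // (subset_trans (normal_sub nK')) ?normal_norm.
have [eqS | neS] := eqVneq (K <*> K' : {set gT}) S; first by rewrite -eqj eqS.
have pr : ((K <*> K')%G \proper S) && (S \subset 'N((K <*> K')%G)).
  by rewrite /= properEneq neS normal_sub // normal_norm.
case/eqP: neq; apply/val_inj.
exact: etrans (esym (maxK _ pr (joing_subl _ _))) (maxK' _ pr (joing_subr _ _)).
Qed.

Lemma maxnormal_chinese (f : {group gT} -> gT) :
    (forall K, maxnormal K S S -> f K \in S) ->
  exists2 g, g \in S & forall K, maxnormal K S S -> g * (f K)^-1 \in K.
Proof.
move=> Sf.
suffices: forall Ks : seq {group gT}, uniq Ks ->
    {in Ks, forall K : {group gT}, maxnormal K S S} ->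
    (exists2 g, g \in S & {in Ks, forall K : {group gT}, g * (f K)^-1 \in K}) /\
    exists A : {group gT}, [/\ A <| S, {in Ks, forall K : {group gT}, A \subset K} &
      forall K, maxnormal K S S -> K \notin Ks -> S \subset K * A].
  case/(_ (enum [pred K : {group gT} | maxnormal K S S])).
  - exact: enum_uniq.
  - by move=> K; rewrite mem_enum.
  by case=> g Sg gK _; exists g => // K maxK; apply: gK; rewrite mem_enum.
elim=> [|K Ks IHKs] /= => [_ _|/andP[notK uniqK] maxKs].
  split; first by exists 1.
  exists S; split=> // K maxK _; apply: mulG_subr.
have maxK : maxnormal K S S by apply: maxKs; rewrite mem_head.
have [|[g Sg gKs] [A [nA sA cA]]] := IHKs uniqK.
  by move=> K' K'in; apply: maxKs; rewrite inE K'in orbT.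
split; last first.
  exists (K :&: A)%G; split=> [|K'|K' maxK'].
  - by rewrite normalI // maxnormal_normal.
  - by rewrite inE => /orP[/eqP->|/sA]; [apply: subsetIl | apply/subset_trans/subsetIr].
  rewrite inE negb_or => /andP[neK notK'].
  apply: perfect_cap_cover (maxnormal_normal _) _ nA _ _ => //.
  - exact: maxnormal_normal.
  - exact: maxnormal_cover.
  - exact: cA.
have Sfg : f K * g^-1 \in S by rewrite groupM ?groupV ?Sf.
have /mulsgP[k a Kk Aa eq_ka] := subsetP (cA K maxK notK) _ Sfg.
exists (a * g); first by rewrite groupM // (subsetP (normal_sub nA)).
move=> K'; rewrite inE => /orP[/eqP->|K'in].
  have ->: a * g = k^-1 * f K by rewrite -[f K](mulgKV g) eq_ka mulgA mulKg.
  by rewrite mulgK groupV.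
by rewrite -mulgA groupM ?gKs // (subsetP (sA _ K'in)).
Qed.

End Chinese.

(** * Lifting one level *)

Section WreathMap.
Variables (gT rT : finGroupType) (I : finType) (S : {group gT}) (f : {morphism S >-> rT}).

Definition wreath_map (w : wreath gT I) : wreath rT I := ([ffun i => f (w.1 i)], w.2).

Lemma wreath_mapM (B : {group {perm I}}) :
  {in wreath_group S B &, {morph wreath_map : u v / u * v}}.
Proof.
move=> u v /in_wreathP[Su _] /in_wreathP[Sv _]; apply: wreathP => // i.
by rewrite labM !ffunE morphM.
Qed.
Canonical wreath_map_morphism B := Morphism (@wreath_mapM B).

Lemma cycle_label_map (x : {perm I}) o (a : {ffun I -> gT}) : (forall i, a i \in S) ->
  cycle_label x o [ffun i => f (a i)] = f (cycle_label x o a).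
Proof.
move=> Sa; have aW : ((a, x) : wreath gT I) \in wreath_group S [group of setT].
  by apply/in_wreathP; split; rewrite ?inE.
have := morphX (wreath_map_morphism [group of setT]) #|porbit x o| aW.
by move/(congr1 (fun w : wreath rT I => w.1 o)); rewrite /= ffunE => /esym.
Qed.

End WreathMap.

Section Step.
Variables (gT : finGroupType) (I : finType) (S : {group gT}) (B : {group {perm I}}).
Variables (x y z : {perm I}) (o : I) (s t : gT).
Hypothesis S_perfect : S^`(1) = S :> {set gT}.
Hypothesis S_gen : <<[set s; t]>> = S :> {set gT}.
Hypothesis B_gen : <<[set x; y; z]>> = B :> {set {perm I}}.
Hypothesis B_trans : forall i, exists2 b, b \in B & b o = i.
Hypothesis stab_neq : forall i j, i != j -> exists2 b, b \in B & b j = j /\ b i != i.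

Hypothesis I_large : 27 <= #|I|.
Hypothesis B_small : #|B| <= 2 ^ (2 * #|I| - 3).

(** The cycle conditions hold for the representatives only modulo K, and are
    made exact once the labellings for the different K have been merged. *)
Lemma generating_labelling_mod (K : {group gT}) : maxnormal K S S ->
  exists l : labelling gT I, [/\ l \in labellings I S, coset K (cycle_label x o l.1.1) = coset K s,
    coset K (cycle_label y o l.1.2) = coset K t &
    <<[set (([ffun i => coset K (l.1.1 i)], x) : wreath (coset_of K) I);
           ([ffun i => coset K (l.1.2 i)], y); ([ffun i => coset K (l.2 i)], z)]>>
    = wreath_group (S / K) B :> {set _}].
Proof.
move=> maxK; have nK := maxnormal_normal maxK; have nKS := normal_norm nK.
have [Ss St] := gen2_mem S_gen.
have simpleT : simple (S / K) by rewrite quotient_simple.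
have perfT : (S / K)^`(1) = S / K by rewrite -quotient_der // S_perfect.
have genT : <<[set coset K s; coset K t]>> = S / K.
  rewrite -S_gen [in RHS]/quotient morphim_gen ?morphimU ?morphim_set1 ?(subsetP nKS) //.
  by apply: subset_trans nKS; rewrite -S_gen subset_gen.
have [a [b [c [[Ta [Tb Tc]] ca cb gen]]]] :=
  simple_generating_labelling simpleT perfT genT B_gen B_trans I_large B_small.
have lift (d : {ffun I -> coset_of K}) : (forall i, d i \in S / K) ->
    exists2 e : {ffun I -> gT}, forall i, e i \in S & d = [ffun i => coset K (e i)].
  move=> Td; have: forall i, exists g, (g \in S) /\ d i = coset K g.
    by move=> i; have /morphimP[g _ Sg ->] := Td i; exists g.
  case/fin_all_exists=> e Pe; exists (finfun e) => [i|]; first by rewrite ffunE; case: (Pe i).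
  by apply/ffunP=> i; rewrite !ffunE; case: (Pe i).
have [[a' Sa' ea] [b' Sb' eb] [c' Sc' ec]] := And3 (lift a Ta) (lift b Tb) (lift c Tc).
have fS : S \subset 'N(K) := nKS.
exists (a', b', c'); rewrite /= -ea -eb -ec; split=> //; first exact/labellingsP.
  rewrite -ca ea; exact: (esym (cycle_label_map (restrm_morphism fS (coset_morphism K)) x o Sa')).
rewrite -cb eb; exact: (esym (cycle_label_map (restrm_morphism fS (coset_morphism K)) y o Sb')).
Qed.

(** The labels at o are not taken from the congruences but solved from the cycle
    conditions.  They still have the right classes modulo K, because the cycle
    condition modulo K determines the label at o from the others. *)
Theorem wreath_large_step : exists a b c : {ffun I -> gT},
  <<[set ((a, x) : wreath gT I); (b, y); (c, z)]>> = wreath_group S B :> {set _}.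
Proof.
have [Ss St] := gen2_mem S_gen.
have /fin_all_exists[L PL] : forall K : {group gT}, exists l : labelling gT I, maxnormal K S S ->
    [/\ l \in labellings I S, coset K (cycle_label x o l.1.1) = coset K s,
    coset K (cycle_label y o l.1.2) = coset K t &
    <<[set (([ffun i => coset K (l.1.1 i)], x) : wreath (coset_of K) I);
           ([ffun i => coset K (l.1.2 i)], y); ([ffun i => coset K (l.2 i)], z)]>>
    = wreath_group (S / K) B :> {set _}].
  move=> K; have [/generating_labelling_mod[l Pl]|_] := boolP (maxnormal K S S); first by exists l.
  by exists ([ffun=> 1], [ffun=> 1], [ffun=> 1]).
have chinese (F : {group gT} -> {ffun I -> gT}) :
    (forall K : {group gT}, maxnormal K S S -> forall i, F K i \in S) ->
    exists2 e : {ffun I -> gT}, forall i, e i \in S &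
      forall K : {group gT}, maxnormal K S S -> forall i, coset K (e i) = coset K (F K i).
  move=> SF; have: forall i, exists g, g \in S /\
      forall K : {group gT}, maxnormal K S S -> coset K g = coset K (F K i).
    move=> i; have [|g Sg gK] := maxnormal_chinese S_perfect (f := fun K => F K i).
      by move=> K maxK; apply: SF.
    exists g; split=> // K maxK; have nKS := normal_norm (maxnormal_normal maxK).
    apply/rcoset_kercosetP; rewrite ?(subsetP nKS) ?SF //.
    by rewrite mem_rcoset gK.
  case/fin_all_exists=> e Pe; exists (finfun e) => [i|K maxK i]; rewrite ffunE.
    by case: (Pe i).
  by case: (Pe i) => _; apply.
have LS (K : {group gT}) (maxK : maxnormal K S S) :=
  let: And4 LK _ _ _ := PL K maxK in labellingsP _ _ LK.
have [|a0 Sa0 a0K] := chinese (fun K => (L K).1.1).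
  by move=> K /LS[].
have [|b0 Sb0 b0K] := chinese (fun K => (L K).1.2).
  by move=> K /LS[].
have [|c Sc cK] := chinese (fun K => (L K).2).
  by move=> K /LS[].
pose a := set_cycle_label x o s a0; pose b := set_cycle_label y o t b0.
have Sa : forall i, a i \in S by apply: set_cycle_label_in.
have Sb : forall i, b i \in S by apply: set_cycle_label_in.
have cosetE (p : {perm I}) g (e0 e : {ffun I -> gT}) (K : {group gT}) : maxnormal K S S ->
    g \in S -> (forall i, e0 i \in S) -> (forall i, e i \in S) ->
    (forall i, coset K (e0 i) = coset K (e i)) -> coset K (cycle_label p o e) = coset K g ->
    [ffun i => coset K (set_cycle_label p o g e0 i)] = [ffun i => coset K (e i)].
  move=> maxK Sg Se0 Se eq_e ce; have nKS := normal_norm (maxnormal_normal maxK).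
  have eq_off j : j != o ->
      [ffun i => coset K (set_cycle_label p o g e0 i)] j = [ffun i => coset K (e i)] j.
    by move=> jo; rewrite !ffunE (negPf jo) eq_e.
  apply/ffunP=> i; have [->|/eq_off//] := eqVneq i o.
  apply: (@cycle_label_inj _ _ p) => //.
  have := cycle_label_map (restrm_morphism nKS (coset_morphism K)) p o.
  rewrite /= /restrm => cm; rewrite !cm ?cycle_label_set //.
  exact: set_cycle_label_in.
have Ka (K : {group gT}) (maxK : maxnormal K S S) :
    [ffun i => coset K (a i)] = [ffun i => coset K ((L K).1.1 i)].
  by have [_ cx _ _] := PL K maxK; have [LSa _ _] := LS K maxK; apply: cosetE => // i; apply: a0K.
have Kb (K : {group gT}) (maxK : maxnormal K S S) :
    [ffun i => coset K (b i)] = [ffun i => coset K ((L K).1.2 i)].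
  by have [_ _ cy _] := PL K maxK; have [_ LSb _] := LS K maxK; apply: cosetE => // i; apply: b0K.
have Kc (K : {group gT}) (maxK : maxnormal K S S) :
    [ffun i => coset K (c i)] = [ffun i => coset K ((L K).2 i)].
  by apply/ffunP=> i; rewrite !ffunE cK.
pose l : labelling gT I := (a, b, c).
have ll : l \in labellings I S by apply/labellingsP.
have HS := lifts_sub B_gen ll; have Htop := lifts_top B_gen l.
have [L1 L2 L3] := lift_mem x y z l.
exists a, b, c.
suffices: lifts_group x y z l = wreath_group S B by move/(congr1 val).
apply: (wreath_mod_max (o := o)) => //.
  rewrite -{1}S_gen gen_subG; apply/subsetP=> g /set2P[] ->.
    rewrite -(cycle_label_set x o s a0).
    exact: (@cycle_label_coord _ _ _ _ (lifts_group x y z l) _ L1).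
  rewrite -(cycle_label_set y o t b0).
  exact: (@cycle_label_coord _ _ _ _ (lifts_group x y z l) _ L2).
move=> K maxK u u1 Su; have nKS := normal_norm (maxnormal_normal maxK).
pose F := wreath_map_morphism (restrm_morphism nKS (coset_morphism K)) B.
have FH : F @* lifts x y z l = wreath_group (S / K) B.
  have [_ _ _ <-] := PL K maxK.
  have sW : [set lift1 x l; lift2 y l; lift3 z l] \subset wreath_group S B.
    by apply: subset_trans HS; apply: subset_gen.
  have W1 := subsetP HS _ L1; have W2 := subsetP HS _ L2; have W3 := subsetP HS _ L3.
  rewrite morphim_gen // !morphimU !morphim_set1 //= /wreath_map /=.
  by rewrite -Ka // -Kb // -Kc.
have uW : u \in wreath_group S B by apply/in_wreathP; rewrite u1.
have: F u \in F @* lifts x y z l.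
  rewrite FH; apply/in_wreathP; rewrite /= u1; split=> // i; rewrite ffunE /=.
  by apply: mem_quotient.
case/morphimP=> [v Wv Hv [/ffunP eq_v eq_2]].
exists v => //; split=> [|i]; first by rewrite -eq_2 u1.
have := eq_v i; rewrite !ffunE /= /restrm => /esym eq_vi.
have [Sv _] := in_wreathP _ _ _ Wv.
rewrite -mem_rcoset; apply/rcoset_kercosetP; rewrite ?(subsetP nKS) //.
Qed.
End Step.

Section BaseStep.
Variables (gT : finGroupType) (I : finType) (S : {group gT}) (B : {group {perm I}}).
Variables (x y : {perm I}) (p q : I) (s t : gT).
Hypothesis S_perfect : S^`(1) = S :> {set gT}.
Hypothesis S_gen : <<[set s; t]>> = S :> {set gT}.
Hypothesis B_gen : <<[set x; y]>> = B :> {set {perm I}}.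
Hypothesis B_trans : forall i j, exists2 b, b \in B & b i = j.
Hypothesis stab_neq : forall i j, i != j -> exists2 b, b \in B & b j = j /\ b i != i.
Hypothesis p_neq_q : p != q.

(** Two points suffice: a conjugate of this element can have p at o while q avoids
    any given j <> o, since the stabiliser of o moves j. *)
Definition two_point : {ffun I -> gT} :=
  [ffun i => if i == p then s else if i == q then t else 1].

Definition base_gens : {set wreath gT I} :=
  [set ([ffun=> 1], x); ([ffun=> 1], y); (two_point, 1)].

Lemma complement_in (b : {perm I}) : b \in B -> (([ffun=> 1], b) : wreath gT I) \in <<base_gens>>.
Proof.
pose E := [set b : {perm I} | (([ffun=> 1], b) : wreath gT I) \in <<base_gens>>].
have gE : group_set E.
  apply/group_setP; split=> [|b1 b2]; rewrite !inE; first exact: group1.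
  move=> h1 h2; suffices -> : (([ffun=> 1], b1 * b2) : wreath gT I) =
      (([ffun=> 1], b1) : wreath gT I) * (([ffun=> 1], b2) : wreath gT I) by rewrite groupM.
  by apply: wreathP => // i; rewrite labM !ffunE mulg1.
suffices sBE : B \subset E by move/(subsetP sBE); rewrite inE.
rewrite -B_gen -[E]/(gval (Group gE)) gen_subG; apply/subsetP=> w /set2P[] ->;
  by rewrite inE mem_gen // !inE eqxx ?orbT.
Qed.

Lemma wreath_base_step : <<base_gens>> = wreath_group S B :> {set _}.
Proof.
have [Ss St] := gen2_mem S_gen.
have [Bx By] : x \in B /\ y \in B by rewrite -B_gen; split; apply: mem_gen; rewrite !inE eqxx ?orbT.
have HS : <<base_gens>> \subset wreath_group S B.
  rewrite gen_subG; apply/subsetP=> w; case/setUP=> [/set2P[]|/set1P] ->;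
    apply/in_wreathP; split=> //= i; rewrite ffunE //.
  by case: ifP => // _; case: ifP.
have Htop b : b \in B -> exists2 h, h \in <<base_gens>> & h.2 = b.
  by move=> Bb; exists ([ffun=> 1], b); first exact: complement_in.
pose c : wreath gT I := (two_point, 1).
have Hc : c \in <<base_gens>> by apply: mem_gen; rewrite !inE eqxx !orbT.
have cJ (b : {perm I}) i : (c ^ (([ffun=> 1], b) : wreath gT I)).1 (b i) = two_point i.
  by have := @lab_conj _ _ c ([ffun=> 1], b) i erefl; rewrite /= => ->; rewrite ffunE conjg1.
have onto1 o j : j != o -> S \subset coord o @* kern <<base_gens>> [set j].
  move=> jo; have move_to k k' : exists2 b, b \in B & b k = o /\ b k' != j.
    have [b Bb bk] := B_trans k o; have [bk'|] := eqVneq (b k') j; last by exists b.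
    have [b' Bb' [b'o b'j]] := stab_neq jo.
    by exists (b * b'); rewrite ?groupM // !permM bk bk'.
  have elt k k' : [set k; k'] = [set p; q] -> two_point k \in coord o @* kern <<base_gens>> [set j].
    move=> eq_kk'; have [b Bb [bk bk']] := move_to k k'.
    apply/kern_coordP; exists (c ^ (([ffun=> 1], b) : wreath gT I)); last by rewrite -bk cJ.
    apply/kernP; rewrite groupJ ?complement_in // top_conj conj1g; split=> // i /set1P->.
    rewrite -(permKV b j) cJ ffunE; set j' := b^-1 j.
    have: j' \notin [set p; q].
      rewrite -eq_kk' !inE negb_or; apply/andP; split.
        by apply: contra jo => /eqP e; rewrite -bk -e permKV.
      by apply: contra bk' => /eqP e; rewrite -e permKV.
    by rewrite !inE negb_or => /andP[/negPf-> /negPf->].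
  rewrite -{1}S_gen gen_subG; apply/subsetP=> g /set2P[] ->.
    by have := elt p q erefl; rewrite ffunE eqxx.
  by have := elt q p (setUC _ _); rewrite ffunE eqxx eq_sym (negPf p_neq_q).
have H0 : S \subset coord p @* kern <<base_gens>> set0.
  have qp : q != p by rewrite eq_sym.
  apply: subset_trans (onto1 p q qp) _; apply: morphimS.
  by apply/subsetP=> u /kernP[Hu u1 _]; apply/kernP; split=> // i; rewrite inE.
suffices: [group of <<base_gens>>] = wreath_group S B by move/(congr1 val).
apply: wreath_sub => //.
apply: base_sub HS (lift_trans Htop (B_trans p)) _.
by apply: kern_coord_onto => // j; apply: onto1.
Qed.
End BaseStep.

(** * Exponentiations *)

Section ExpMap.
Variables m n : nat.

Definition exp_map (w : wreath {perm 'I_m} 'I_n) : {perm 'I_(m ^ n)} := exp_perm w.1 w.2.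

Lemma exp_mapM : {in [set: wreath {perm 'I_m} 'I_n] &, {morph exp_map : u v / u * v}}.
Proof. by move=> u v _ _; rewrite /exp_map exp_permM. Qed.
Canonical exp_map_morphism := Morphism exp_mapM.

Lemma exp_map_im (A : {group {perm 'I_m}}) (B : {group {perm 'I_n}}) :
  exp_map @* wreath_group A B = exponentiation A B.
Proof.
apply/setP=> g; apply/morphimP/exponentiationP => [[w _ /in_wreathP[Aw Bw] ->]|[a [b [Aa Bb ->]]]].
  by exists w.1, w.2.
by exists ((a, b) : wreath {perm 'I_m} 'I_n); rewrite ?in_setT //; apply/in_wreathP.
Qed.

Lemma exponentiation_gen (A : {group {perm 'I_m}}) (B : {group {perm 'I_n}})
    (u v w : wreath {perm 'I_m} 'I_n) :
  <<[set u; v; w]>> = wreath_group A B :> {set _} ->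
  <<[set exp_map u; exp_map v; exp_map w]>> = exponentiation A B :> {set _}.
Proof.
by move=> gen; rewrite -exp_map_im -gen morphim_gen ?subsetT // !morphimU !morphim_set1 ?inE.
Qed.

End ExpMap.

Definition point_transitive n (B : {set {perm 'I_n}}) :=
  forall i j, exists2 b, b \in B & b i = j.
Definition stab_distinct n (B : {set {perm 'I_n}}) :=
  forall i j, i != j -> exists2 b : {perm 'I_n}, b \in B & b j = j /\ b i != i.

(** Point stabilisers in a transitive group have equal orders, so distinct ones
    are not contained in each other. *)
Lemma transitive_stab_distinct n (B : {group {perm 'I_n}}) : point_transitive B ->
  (forall i j : 'I_n, i <> j -> 'C_B[i | 'P] <> 'C_B[j | 'P] :> {set {perm 'I_n}}) ->
  stab_distinct B.
Proof.
move=> Btrans stab i j /eqP ij.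
have [b Bb bji] := Btrans j i.
have cardC : #|'C_B[i | 'P]| = #|'C_B[j | 'P]|.
  have ->: 'C_B[i | 'P] = 'C_B[j | 'P] :^ b.
    by rewrite conjIg conjGid // -astab1_act /= /aperm bji.
  by rewrite cardJg.
have /subsetPn[c /setIP[Bc /astab1P cj] notc] : ~~ ('C_B[j | 'P] \subset 'C_B[i | 'P]).
  by apply/negP=> sub; case: (stab i j ij); apply/esym/eqP; rewrite eqEcard sub cardC leqnn.
exists c => //; split=> //; apply: contra notc => /eqP ci.
by apply/setIP; split=> //; apply/astab1P.
Qed.

Section ExpProperties.
Variables m n : nat.
Variables (A : {group {perm 'I_m}}) (B : {group {perm 'I_n}}).

Lemma exponentiation_trans : point_transitive A -> point_transitive (exponentiation A B).
Proof.
move=> Atrans i j; rewrite -(lex_unrankK i) -(lex_unrankK j).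
have: forall t, exists a, a \in A /\ a (lex_unrank i t) = lex_unrank j t.
  by move=> t; have [a Aa ai] := Atrans (lex_unrank i t) (lex_unrank j t); exists a.
case/fin_all_exists=> a Pa; exists (exp_perm (finfun a) 1).
  by apply/exponentiationP; exists (finfun a), 1; split=> // t; rewrite ffunE; case: (Pa t).
rewrite exp_permE; congr lex_rank; apply/ffunP=> t.
by rewrite !ffunE invg1 perm1; case: (Pa t).
Qed.

(** Two functions that differ at t are separated by a base element supported
    at t. *)
Lemma exponentiation_stab_distinct : stab_distinct A -> stab_distinct (exponentiation A B).
Proof.
move=> Astab i j ij.
have [t ne_t] : exists t, lex_unrank i t != lex_unrank j t.
  apply/existsP; apply: contraR ij => /existsPn eq_ij; rewrite -(lex_unrankK i) -(lex_unrankK j).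
  by apply/eqP; congr lex_rank; apply/ffunP=> t; apply/eqP/negPn/eq_ij.
have [a Aa [aj ai]] := Astab _ _ ne_t.
pose a' := [ffun t' => if t' == t then a else 1].
exists (exp_perm a' 1).
  by apply/exponentiationP; exists a', 1; split=> // t'; rewrite ffunE; case: ifP.
rewrite -(lex_unrankK i) -(lex_unrankK j) !exp_permE (inj_eq (@lex_rank_inj m n)); split.
  congr lex_rank; apply/ffunP=> t'; rewrite !ffunE invg1 perm1.
  by case: eqP => [->|_]; rewrite ?perm1.
apply: contra ai => /eqP/ffunP/(_ t); rewrite !ffunE invg1 perm1 eqxx => e.
by rewrite e.
Qed.

Lemma factorial_le k : k`! <= 2 ^ (k.-1 ^ 2).
Proof.
elim: k => // -[|k] IHk //; rewrite factS; apply: leq_trans (leq_mul (ltn_expl _ (ltnSn 1)) IHk) _.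
by rewrite -expnD leq_exp2l //=; nia.
Qed.

Lemma exponentiation_degree : 3 <= m -> 3 <= n -> 27 <= m ^ n.
Proof.
move=> m3 n3; apply: leq_trans (_ : 3 ^ n <= _); last by rewrite leq_exp2r // (leq_trans _ n3).
by rewrite -[27]/(3 ^ 3)%N leq_exp2l.
Qed.

Lemma card_exponentiation : 3 <= m -> 3 <= n ->
  #|exponentiation A B| <= 2 ^ (2 * m ^ n - 3).
Proof.
move=> m3 n3; rewrite -exp_map_im.
apply: leq_trans (leq_imset_card _ _) _.
apply: leq_trans (max_card _) _.
have -> : #|{: wreath {perm 'I_m} 'I_n}| = (m`! ^ n * n`!)%N.
  by rewrite card_prod card_ffun !card_Sn card_ord.
apply: leq_trans (_ : (2 ^ (m.-1 ^ 2)) ^ n * 2 ^ (n.-1 ^ 2) <= _).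
  by rewrite leq_mul ?factorial_le // leq_exp2r ?factorial_le // (leq_trans _ n3).
rewrite -expnM -expnD leq_exp2l //.
have pow3 k : 3 <= k -> k <= 3 ^ (k - 2) /\ k ^ 2 + 3 <= 3 ^ k.
  elim: k => // k IHk; rewrite leq_eqVlt => /orP[/eqP<- //|]; rewrite ltnS => k3.
  have [e1 e2] := IHk k3; rewrite subSn ?(leq_trans _ k3) // !expnS.
  by split; lia.
have [e1 e2] := pow3 n n3.
have le3 : n ^ 2 + 3 <= m ^ n.
  by apply: leq_trans e2 _; rewrite leq_exp2r // (leq_trans _ n3).
have le2 : m ^ 2 * n <= m ^ n.
  rewrite -[X in _ <= m ^ X](subnKC (leq_trans (isT : 2 <= 3) n3)) expnD leq_mul2l.
  by rewrite (leq_trans e1) ?orbT // leq_exp2r // subn_gt0.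
have l1 : m.-1 ^ 2 * n <= m ^ 2 * n by rewrite leq_mul2r leq_exp2r // leq_pred orbT.
have l2 : n.-1 ^ 2 <= n ^ 2 by rewrite leq_exp2r // leq_pred.
lia.
Qed.
End ExpProperties.

(** A group of permutations of two points is abelian. *)
Lemma perfect_degree_ge3 n (A : {group {perm 'I_n}}) :
  1 < n -> A^`(1) = A :> {set _} -> point_transitive A -> 3 <= n.
Proof.
move=> n_gt1 perfA transA; rewrite leqNgt ltnS; apply/negP=> n_le2.
have n2 : n = 2 by apply/eqP; rewrite eqn_leq n_le2.
have A1 : A :=: 1.
  rewrite -perfA; apply/derG1P/cyclic_abelian.
  have: #|A| <= 2 by apply: leq_trans (max_card _) _; rewrite card_Sn n2.
  rewrite leq_eqVlt => /orP[/eqP c2|]; first by apply: prime_cyclic; rewrite c2.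
  by rewrite ltnS -trivg_card_le1 => /eqP->; apply: cyclic1.
have [b] := transA (Ordinal (ltnW n_gt1)) (Ordinal n_gt1).
by rewrite A1 => /set1P->; rewrite perm1.
Qed.

(** * Topological generation of an inverse limit *)

Section Density.
Variables (gT : nat -> finGroupType) (G : forall k, {group gT k}).
Variable pi : forall k, {morphism G k.+1 >-> gT k}.
Local Open Scope classical_set_scope.
Local Notation L := (inv_lim pi).

Lemma subgroup_generatedP (X : set L) : is_subgroup (subgroup_generated X).
Proof.
split=> [H [[H1 _] _] //|x y Xx Xy H HX].
by have [[_ HM] _] := HX; apply: HM; [apply: Xx|apply: Xy].
Qed.

Lemma inv_lim_eq_below (x y : L) K k : (k <= K)%N -> val x K = val y K -> val x k = val y k.
Proof.
elim: K => [|K IHK]; first by rewrite leqn0 => /eqP->.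
rewrite leq_eqVlt => /orP[/eqP->//|]; rewrite ltnS => kK eqK; apply: IHK => //.
by rewrite -(inv_lim_compat x K) -(inv_lim_compat y K) eqK.
Qed.

(** Agreement with p at level k forces agreement below k, so elements of A that
    agree with p at higher and higher levels converge to p. *)
Lemma inv_lim_dense (A : set L) :
  (forall (p : L) k, exists2 w, A w & val w k = val p k) -> dense A.
Proof.
move=> near_A O [p Op] oO.
have: forall k, exists w, A w /\ val w k = val p k by move=> k; have [w] := near_A p k; exists w.
move/choice=> [w Aw].
case: oO Op => W oW <- Wp.
have w_cvg : (fun N => val (w N)) @ \oo -->
    (val p : prod_topology (fun k => discrete_topology (gT k))).
  apply/cvg_sup => k U [V [[C _ <-] /= Cp] sub_CU].
  exists k => // N /= kN; apply: sub_CU => /=; rewrite /proj.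
  have [_ /(inv_lim_eq_below kN) eq_k] := Aw N.
  by rewrite /proj in Cp *; rewrite eq_k.
have [N _ NW] := w_cvg W (open_nbhs_nbhs (conj oW Wp)).
exists (w N); split; last by case: (Aw N).
exact: NW (leqnn N).
Qed.

Lemma inv_lim_topologically_generates (x y z : L) :
    (forall k, <<[set (val x k : gT k); val y k; val z k]%SET>> = G k :> {set gT k}) ->
  topologically_generates [set x; y; z].
Proof.
move=> gen; apply: inv_lim_dense => p k.
have [X1 XV] := subgroup_generatedP [set x; y; z].
have Xgen w : [set x; y; z] w -> subgroup_generated [set x; y; z] w by move=> Xw H [_]; apply.
pose E := [set g : gT k | `[< exists2 w, subgroup_generated [set x; y; z] w & val w k = g >]]%SET.
have gE : group_set E.
  apply/group_setP; split=> [|g h]; rewrite !inE.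
    by apply/asboolP; exists 1.
  move=> /asboolP[v Xv <-] /asboolP[w Xw <-]; apply/asboolP; exists (v * w) => //.
  rewrite -[w]invgK; apply: (XV) => //; rewrite -[w^-1]mul1g; exact: XV.
suffices: (val p k : gT k) \in E by rewrite inE => /asboolP.
have sGE : G k \subset E.
  rewrite -gen -[E]/(gval (Group gE)) gen_subG; apply/fintype.subsetP=> g.
  case/setUP=> [/set2P[]|/set1P] ->; rewrite inE; apply/asboolP.
  - by exists x => //; apply: Xgen; left; left.
  - by exists y => //; apply: Xgen; left; right.
  - by exists z => //; apply: Xgen; right.
by apply: (fintype.subsetP sGE); apply: inv_lim_mem.
Qed.
End Density.

Lemma gen_setU1 (gT : finGroupType) (A : {set gT}) : <<A :|: [set 1]>> = <<A>>.
Proof.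
apply/eqP; rewrite eqEsubset gen_subG subUset subset_gen sub1set group1 /=.
by rewrite genS ?subsetUl.
Qed.

(** * The generators *)

Section Tower.
Variables (m : nat -> nat) (S : forall k, {group {perm 'I_(m k)}}).
Hypothesis m_gt1 : forall k, 1 < m k.
Hypothesis S_perfect : forall k, (S k)^`(1) = S k :> {set {perm 'I_(m k)}}.
Hypothesis S_2gen : forall k, exists a b : {perm 'I_(m k)},
  <<[set a; b]>> = S k :> {set {perm 'I_(m k)}}.
Hypothesis S_trans : forall k, point_transitive (S k).
Hypothesis S_stab : forall k, stab_distinct (S k).

Local Notation deg := (iter_exp_deg m).
Local Notation G := (iter_exp S).

Lemma degree_ge3 k : 3 <= m k.
Proof. exact: perfect_degree_ge3 (m_gt1 k) (S_perfect k) (@S_trans k). Qed.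

Lemma iter_exp_deg_ge3 k : 3 <= deg k.
Proof.
elim: k => [|k IHk] /=; first exact: degree_ge3.
exact: leq_trans (exponentiation_degree (degree_ge3 _) IHk).
Qed.

Lemma iter_exp_trans k : point_transitive (G k).
Proof. by elim: k => [|k IHk] //=; apply: exponentiation_trans. Qed.

Lemma iter_exp_stab_distinct k : stab_distinct (G k).
Proof. by elim: k => [|k IHk] //=; apply: exponentiation_stab_distinct. Qed.

Definition triple k : Type := ({perm 'I_(deg k)} * {perm 'I_(deg k)} * {perm 'I_(deg k)})%type.

(** The last component is trivial at the bottom level, which the first lift
    uses. *)
Definition generating k (w : triple k) : Prop :=
  <<[set w.1.1; w.1.2; w.2]>> = G k :> {set _} /\ (k = 0 -> w.2 = 1).

Lemma generating0 : exists w : triple 0, generating w.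
Proof.
have [a [b gen]] := S_2gen 0; exists (a, b, 1); split=> //=.
by rewrite -[RHS]gen gen_setU1.
Qed.

Lemma generating_step k (w : triple k) : generating w ->
  exists w' : triple k.+1, generating w' /\
    [/\ exp_proj w'.1.1 = w.1.1, exp_proj w'.1.2 = w.1.2 & exp_proj w'.2 = w.2].
Proof.
case: w => [[x y] z] [/= gen z1].
have [s [t S_gen]] := S_2gen k.+1.
have gt0 : 0 < deg k by apply: leq_trans (iter_exp_deg_ge3 k).
suffices [a [b [c gen']]] : exists a b c : {ffun 'I_(deg k) -> {perm 'I_(m k.+1)}},
    <<[set ((a, x) : wreath {perm 'I_(m k.+1)} 'I_(deg k)); (b, y); (c, z)]>>
    = wreath_group (S k.+1) (G k) :> {set _}.
  exists (exp_perm a x, exp_perm b y, exp_perm c z); split; last by rewrite !exp_projE.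
  by split=> //; exact: (exponentiation_gen gen').
have trans := @iter_exp_trans k; have stab := @iter_exp_stab_distinct k.
case: k x y z gen z1 s t S_gen gt0 trans stab => [|k] x y z gen z1 s t S_gen gt0 trans stab.
  have gt1 : 1 < deg 0 := m_gt1 0.
  exists [ffun=> 1], [ffun=> 1], (two_point (Ordinal gt0) (Ordinal gt1) s t).
  have -> : z = 1 by apply: z1.
  apply: (wreath_base_step (S_perfect 1) S_gen _ trans stab) => //.
  by rewrite -gen z1 // gen_setU1.
have large : 27 <= #|'I_(deg k.+1)|.
  by rewrite card_ord exponentiation_degree ?degree_ge3 ?iter_exp_deg_ge3.
have small : #|G k.+1| <= 2 ^ (2 * #|'I_(deg k.+1)| - 3).
  by rewrite card_ord card_exponentiation ?degree_ge3 ?iter_exp_deg_ge3.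
exact: (wreath_large_step (S_perfect _) S_gen gen (trans (Ordinal gt0)) stab large small).
Qed.

Fixpoint tower k : {w : triple k | generating w} :=
  match k with
  | 0 => cid generating0
  | k'.+1 => let w' := cid (generating_step (svalP (tower k'))) in
             exist _ (sval w') (svalP w').1
  end.

Lemma tower_proj k : [/\ exp_proj (sval (tower k.+1)).1.1 = (sval (tower k)).1.1,
  exp_proj (sval (tower k.+1)).1.2 = (sval (tower k)).1.2 &
  exp_proj (sval (tower k.+1)).2 = (sval (tower k)).2].
Proof. exact: (svalP (cid (generating_step (svalP (tower k))))).2. Qed.

Lemma tower_mem k : [/\ (sval (tower k)).1.1 \in G k, (sval (tower k)).1.2 \in G k &
  (sval (tower k)).2 \in G k].
Proof.
by have [<- _] := svalP (tower k); split; apply: mem_gen; rewrite !inE eqxx ?orbT.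
Qed.

Theorem iter_exp_topologically_generated :
  exists x y z : infinitely_iterated_exponentiation S m_gt1,
    topologically_generates [set x; y; z]%classic.
Proof.
have lim1 : inv_lim_set (iter_exp_proj S m_gt1) (fun k => (sval (tower k)).1.1).
  by move=> k; have [? _ _] := tower_mem k; have [? _ _] := tower_proj k.
have lim2 : inv_lim_set (iter_exp_proj S m_gt1) (fun k => (sval (tower k)).1.2).
  by move=> k; have [_ ? _] := tower_mem k; have [_ ? _] := tower_proj k.
have lim3 : inv_lim_set (iter_exp_proj S m_gt1) (fun k => (sval (tower k)).2).
  by move=> k; have [_ _ ?] := tower_mem k; have [_ _ ?] := tower_proj k.
exists (SigSub (mem_set lim1)), (SigSub (mem_set lim2)), (SigSub (mem_set lim3)).
apply: inv_lim_topologically_generates => k /=.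
by have [] := svalP (tower k).
Qed.
End Tower.

Theorem corollary5 (m : nat -> nat) (S : forall k, {group {perm 'I_(m k)}})
  (m_gt1 : forall k, 1 < m k)
  (S_perfect : forall k, (S k)^`(1) = S k :> {set {perm 'I_(m k)}})
  (S_2gen : forall k, exists a b : {perm 'I_(m k)}, <<[set a; b]>> = S k :> {set {perm 'I_(m k)}})
  (S_trans : forall k, [transitive S k, on [set: 'I_(m k)] | 'P])
  (S_stab : forall k (i j : 'I_(m k)), i <> j ->
     'C_(S k)[i | 'P] <> 'C_(S k)[j | 'P] :> {set {perm 'I_(m k)}}) :
  exists x y z : infinitely_iterated_exponentiation S m_gt1,
    topologically_generates [set x; y; z]%classic.
Proof.
have trans k : point_transitive (S k).
  move=> i j; have := atransP2 (S_trans k) (in_setT i) (in_setT j).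
  by case=> b Sb ->; exists b.
apply: iter_exp_topologically_generated => // k; exact: transitive_stab_distinct (@S_stab k).
Qed.
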